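(* Let $d_e\le d$ be fixed. There is a quantity $\tau_{\boldsymbol 0}=\tau_{\boldsymbol 0}(D)>0$ (for integers $D>d_e$) satisfying $$\tau_{\boldsymbol 0}=\Theta\left(\frac{\log(D-d_e+1)^{\frac{d-1}{2}}}{(D-d_e+1)^{d_e}}\right)\quad\text{as }D\to\infty,$$ where the constants in $\Theta(\cdot)$ depend only on $d_e$ and $d$, such that the following holds. Let $f:\mathbb{R}^D\to\mathbb{R}$ be continuous with effective dimension $d_e<D$, with effective subspace $\mathcal{T}$ and constant subspace $\mathcal{T}^\perp$ spanned by the columns of $U=[I_{d_e}\;0]^T\in\mathbb{R}^{D\times d_e}$ and $V=[0\;I_{D-d_e}]^T\in\mathbb{R}^{D\times(D-d_e)}$, respectively, let $A$ be a $D\times d$ Gaussian matrix, and let $\boldsymbol{p}=\boldsymbol{0}$. Then $$\mathbb{P}[(\mathrm{RP}\mathcal{X})\text{ is successful}]\ge\tau_{\boldsymbol 0}>0.$$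
   Context: A function $f:\mathbb{R}^D\to\mathbb{R}$ has effective dimension $d_e$ if there is a linear subspace $\mathcal{T}$ of dimension $d_e$ such that $f(\boldsymbol{x}_\top+\boldsymbol{x}_\perp)=f(\boldsymbol{x}_\top)$ for all $\boldsymbol{x}_\top\in\mathcal{T}$ and $\boldsymbol{x}_\perp\in\mathcal{T}^\perp$, and $d_e$ is the smallest integer with this property. $\mathcal{T}$ and $\mathcal{T}^\perp$ are called the effective and constant subspaces of $f$. A Gaussian matrix is a random matrix with independent $\mathcal{N}(0,1)$ entries. Let $\mathcal{X}=[-1,1]^D$ and $f^*=\min_{\boldsymbol{x}\in\mathcal{X}}f(\boldsymbol{x})$. The reduced problem $(\mathrm{RP}\mathcal{X})$ is: minimize $f(A\boldsymbol{y}+\boldsymbol{p})$ over $\boldsymbol{y}\in\mathbb{R}^d$ subject to $A\boldsymbol{y}+\boldsymbol{p}\in\mathcal{X}$. It is successful if there exists $\boldsymbol{y}^*\in\mathbb{R}^d$ with $f(A\boldsymbol{y}^*+\boldsymbol{p})=f^*$ and $A\boldsymbol{y}^*+\boldsymbol{p}\in\mathcal{X}$. $a(D)=\Theta(b(D))$ as $D\to\infty$ means that there are positive constants $M_1,M_2$ and $D_0$ with $M_1b(D)\le|a(D)|\le M_2b(D)$ for all $D\ge D_0$. $\log(x)^{q}$ denotes $(\log x)^q$. *)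

(* Defs.v *)
From HB Require Import structures.
From mathcomp Require Import all_boot all_order all_algebra.
From mathcomp Require Import all_classical all_reals all_analysis.
Set Implicit Arguments.
Unset Strict Implicit.
Unset Printing Implicit Defensive.
Import Order.TTheory GRing.Theory Num.Theory numFieldNormedType.Exports.
Local Open Scope classical_set_scope.
Local Open Scope ring_scope.

Definition dotmx {R : realType} {D : nat} (u v : 'cV[R]_D) : R :=
  \sum_(i < D) u i 0 * v i 0.

Definition orthocomp {R : realType} {D : nat} (T : {vspace 'cV[R]_D}) :
    set 'cV[R]_D :=
  [set v | forall u, u \in T -> dotmx u v = 0].

Definition colspan {R : realType} {D k : nat} (M : 'M[R]_(D, k)) :
    {vspace 'cV[R]_D} :=
  <<[seq col j M | j <- enum 'I_k]>>%VS.

Definition constant_along_orthocomp {R : realType} {D : nat}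
    (f : 'cV[R]_D -> R) (T : {vspace 'cV[R]_D}) : Prop :=
  forall x y : 'cV[R]_D, x \in T -> orthocomp T y -> f (x + y) = f x.

Definition effective_dimension {R : realType} {D : nat}
    (f : 'cV[R]_D -> R) (de : nat) : Prop :=
  (exists2 T : {vspace 'cV[R]_D}, \dim T = de & constant_along_orthocomp f T) /\
  (forall T : {vspace 'cV[R]_D}, constant_along_orthocomp f T ->
    (de <= \dim T)%N).

Definition effective_subspace {R : realType} {D : nat}
    (f : 'cV[R]_D -> R) (T : {vspace 'cV[R]_D}) : Prop :=
  effective_dimension f (\dim T) /\ constant_along_orthocomp f T.

(* [I_de 0]^T *)
Definition Umx (R : realType) (D de : nat) : 'M[R]_(D, de) :=
  \matrix_(i < D, j < de) (i == j :> nat)%:R.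

(* [0 I_(D - de)]^T *)
Definition Vmx (R : realType) (D de : nat) : 'M[R]_(D, D - de) :=
  \matrix_(i < D, j < D - de) (i == (de + j)%N :> nat)%:R.

Definition cube {R : realType} {D : nat} : set 'cV[R]_D :=
  [set x | forall i, -1 <= x i 0 <= 1].

(* The infimum is a minimum for continuous f, see fstar_attained. *)
Definition fstar {R : realType} {D : nat} (f : 'cV[R]_D -> R) : R :=
  inf [set f x | x in cube].

Lemma compact_cube (R : realType) (D : nat) : compact (@cube R D).
Proof.
have cont_tr : continuous (fun v : 'rV[R]_D => v^T : 'cV[R]_D).
  move=> v A [B vB BA].
  exists (fun i j => B j i); first by move=> i j; have := vB j i; rewrite mxE.
  by move=> w wB; apply: BA => i j; rewrite mxE; exact: wB.
have := @rV_compact R D (fun=> `[(-1 : R), 1]%classic)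
  (fun=> @segment_compact R (-1) 1).
move=> /(continuous_compact (continuous_subspaceT cont_tr)).
congr compact; apply/seteqP; split => [_ [v vP <-] i|x xP].
  by have := vP i; rewrite /= in_itv/= mxE.
exists x^T; last by rewrite trmxK.
by move=> i; rewrite /= in_itv/= mxE; exact: xP.
Qed.

Lemma fstar_attained (R : realType) (D : nat) (f : 'cV[R]_D -> R) :
  continuous f ->
  (exists2 x, cube x & f x = fstar f) /\
  (forall x, cube x -> fstar f <= f x).
Proof.
move=> cf.
have c0 : cube (0 : 'cV[R]_D) by move=> i; rewrite mxE lerN10 ler01.
have [||x xc xmin] := @compact_EVT_min _ R f cube _ (compact_cube (D := D)) _.
- by exists 0.
- exact: continuous_subspaceT.
have lb : lbound [set f x | x in cube] (f x).
  by move=> _ [y yc <-]; apply: xmin; exact/mem_set.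
have fxE : f x = fstar f.
  apply/eqP; rewrite eq_le; apply/andP; split.
    by apply: lb_le_inf => //; exists (f 0), 0.
  apply: ge_inf; first by exists (f x).
  by exists x => //; exact/set_mem.
split; first by exists x => //; exact/set_mem.
by move=> y yc; rewrite -fxE; apply: xmin; exact/mem_set.
Qed.

Definition RPX_successful {R : realType} {D d : nat} (f : 'cV[R]_D -> R)
    (A : 'M[R]_(D, d)) (p : 'cV[R]_D) : Prop :=
  exists y : 'cV[R]_d, f (A *m y + p) = fstar f /\ cube (A *m y + p).

Definition mutually_independent {d : measure_display} {Omega : measurableType d}
    {R : realType} (P : probability Omega R) {I : finType}
    (X : I -> Omega -> R) : Prop :=
  forall (J : {set I}) (B : I -> set R), (forall i, measurable (B i)) ->
    P (\bigcap_(i in [set` J]) X i @^-1` B i) =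
    (\prod_(i in J) P (X i @^-1` B i))%E.

(* Laws are compared on Borel sets only: a measure also assigns an unspecified
   value to each nonmeasurable set. *)
Definition gaussian_matrix {disp : measure_display}
    {Omega : measurableType disp} {R : realType} (P : probability Omega R)
    {D d : nat} (A : Omega -> 'M[R]_(D, d)) : Prop :=
  [/\ forall i j, measurable_fun setT (fun w => A w i j),
      forall i j (B : set R), measurable B ->
        P ((fun w => A w i j) @^-1` B) = normal_prob 0 1 B
    & mutually_independent P (fun (ij : 'I_D * 'I_d) w => A w ij.1 ij.2)].

(* Main.v *)
Require Import Defs.
From HB Require Import structures.
From mathcomp Require Import all_boot all_order all_algebra.
From mathcomp Require Import all_classical all_reals all_analysis.
From mathcomp Require Import measurable_realfun.
From mathcomp Require Import ring lra.
Set Implicit Arguments.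
Unset Strict Implicit.
Unset Printing Implicit Defensive.
Import Order.TTheory GRing.Theory Num.Theory numFieldNormedType.Exports.
Import HBNNSimple.
Local Open Scope classical_set_scope.
Local Open Scope ring_scope.

(* Let x* be a minimizer of f on the cube and z its first de coordinates, with
   |z_k0| maximal among the |z_k|. Since f only sees these coordinates, success
   follows from a vector y with A_top y = z and |b . y| <= 1 for each of the
   N = D - de bottom rows b of A. Fix h with h exp(h^2/2) of order N + 1. If
   |y| <= 1/h, then b . y is a centered Gaussian of deviation at most 1/h, so
   each bottom row fails with probability at most exp(-h^2/2)/h, and all of
   them succeed with probability at least 1/2. It remains to bound below the
   probability that A_top y = z has such a solution. Row k0 =: a is required to
   have |a|^2 in an interval of length 1 slightly above h^2, in a cone around
   the k0-th axis: this has probability of order h^(d-1) exp(-h^2/2)/h. Every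
   other top row is required to be (z_k/z_k0) a + x_k, where x_k is close to the
   k-th basis vector and |x_k . a| <= 1: this has probability of order
   exp(-h^2/2)/h. On this event the system has a solution with |y| <= 1/h. The
   product of these probabilities is of order h^(d-1)/(N+1)^de, and h^2 is at
   least ln(N+1). *)

(** * Gaussian integrals *)

(** No measurability is required: the integral of a nonnegative function is a supremum over the
    simple functions below it. Iterated integrals can thus be bounded below without studying the
    measurability of the inner ones. *)
Lemma le_integralT d (T : measurableType d) (R : realType)
    (mu : {measure set T -> \bar R}) (f g : T -> \bar R) :
  (forall x, 0 <= f x)%E -> (forall x, f x <= g x)%E ->
  (\int[mu]_x f x <= \int[mu]_x g x)%E.
Proof.
move=> f0 fg; have g0 x : (0 <= g x)%E by exact: le_trans (fg x).
rewrite !ge0_integralTE//; apply: ereal_sup_le => _ [h hf <-].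
by exists h => // x; exact: le_trans (hf x) (fg x).
Qed.

(** Indicators first, then simple functions by linearity, then monotone convergence along
    [nnsfun_approx]. *)
Lemma integral_density d (T : measurableType d) (R : realType)
    (mu nu : {measure set T -> \bar R}) (p : T -> R) (f : T -> \bar R) :
  measurable_fun setT p -> (forall x, 0 <= p x) ->
  (forall A, measurable A -> nu A = \int[mu]_(x in A) (p x)%:E)%E ->
  measurable_fun setT f -> (forall x, 0 <= f x)%E ->
  (\int[nu]_x f x = \int[mu]_x (f x * (p x)%:E))%E.
Proof.
move=> mp p0 nuE mf f0.
have mp' : measurable_fun setT (fun x => (p x)%:E) by exact/measurable_EFinP.
pose f_ := nnsfun_approx measurableT mf.
have indicE' E : measurable E ->
    (\int[nu]_x (\1_E x)%:E = \int[mu]_x ((\1_E x)%:E * (p x)%:E))%E.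
  move=> mE; rewrite integral_indic// setIT nuE// integral_mkcond.
  apply: eq_integral => x _; rewrite patchE indicE; case: ifPn => xE.
    by rewrite mul1e.
  by rewrite mul0e.
have sfunE (h : {nnsfun T >-> R}) :
    (\int[nu]_x (h x)%:E = \int[mu]_x ((h x)%:E * (p x)%:E))%E.
  under [LHS]eq_integral do rewrite fimfunE -fsumEFin//.
  rewrite [LHS]ge0_integral_fsum//; last 2 first.
    - by move=> r; exact/measurable_EFinP/measurableT_comp.
    - by move=> n x _; rewrite EFinM nnfun_muleindic_ge0.
  transitivity (\int[mu]_x (\sum_(y \in range h)
      ((y * \1_(h @^-1` [set y]) x)%:E * (p x)%:E))%E)%E; last first.
    apply: eq_integral => x _; rewrite [in RHS]fimfunE -fsumEFin//.
    by rewrite ge0_mule_fsuml// => r; rewrite EFinM nnfun_muleindic_ge0.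
  rewrite ge0_integral_fsum//; last 2 first.
    - move=> r; apply: emeasurable_funM => //.
      exact/measurable_EFinP/measurableT_comp.
    - move=> n x _; apply: mule_ge0; last by rewrite lee_fin.
      exact: (nnfun_muleindic_ge0 h).
  apply: eq_fsbigr => r /[!inE] -[t _ <-].
  have ht0 : 0 <= h t by [].
  have mht : measurable (h @^-1` [set h t]) by [].
  rewrite (eq_integral (fun x => (h t)%:E * (\1_(h @^-1` [set h t]) x)%:E)%E)//.
  rewrite ge0_integralZl//; last first.
    exact/measurable_EFinP/measurable_indic.
  rewrite indicE'//.
  rewrite [RHS](eq_integral (fun x =>
    (h t)%:E * ((\1_(h @^-1` [set h t]) x)%:E * (p x)%:E))%E); last first.
    by move=> x _; rewrite EFinM muleA.
  rewrite [RHS]ge0_integralZl//.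
  - by apply: emeasurable_funM => //; exact/measurable_EFinP/measurable_indic.
  - by move=> x _; rewrite mule_ge0 ?lee_fin.
transitivity (lim (\int[nu]_x (f_ n x)%:E @[n --> \oo])%E).
  rewrite -monotone_convergence//=.
  - apply: eq_integral => ? /[!inE] xD; apply/esym/cvg_lim => //=.
    exact: cvg_nnsfun_approx.
  - by move=> n; exact/measurable_EFinP/measurable_funTS.
  - by move=> n ? _; rewrite lee_fin.
  - by move=> ? _ ? ? mn; rewrite lee_fin; exact/lefP/nd_nnsfun_approx.
transitivity (lim (\int[mu]_x ((f_ n x)%:E * (p x)%:E) @[n --> \oo])%E).
  by apply: congr_lim; apply/funext => n; exact: sfunE.
rewrite -monotone_convergence//=.
- apply: eq_integral => x /[!inE] xD; apply/cvg_lim => //=.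
  under eq_cvg do rewrite muleC.
  rewrite muleC; apply: cvgeZl => //.
  exact: cvg_nnsfun_approx.
- move=> n; apply: emeasurable_funM => //.
  exact/measurable_EFinP/measurable_funTS.
- by move=> n x _; rewrite mule_ge0// lee_fin.
- move=> x _ m n mn; rewrite lee_wpmul2r ?lee_fin//.
  exact/lefP/nd_nnsfun_approx.
Qed.

Section gaussian_iteration.
Context {R : realType}.
Notation gam := (normal_prob (0 : R) 1).

Lemma normal_pdf01E (x : R) :
  normal_pdf 0 1 x = (Num.sqrt (pi *+ 2))^-1 * expR (- x ^+ 2 / 2).
Proof.
rewrite normal_pdfE ?oner_eq0// /normal_peak /normal_fun subr0 !expr1n.
by rewrite mul1r.
Qed.

Lemma integral_gam (f : R -> \bar R) :
  measurable_fun setT f -> (forall x, 0 <= f x)%E ->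
  (\int[gam]_x f x =
   \int[lebesgue_measure]_x (f x * (normal_pdf 0 1 x)%:E))%E.
Proof.
by move=> mf f0; apply: integral_density => //;
  [exact: measurable_normal_pdf|exact: normal_pdf_ge0].
Qed.

(** The factor [expR (t ^+ 2 / 2)] cancels the Gaussian density, so that only the length of the
    interval remains. Since [g] may fail to be measurable, it is replaced by an explicit minorant
    supported on the interval. *)
Lemma integral_gam_ge (g : R -> \bar R) (c a b : R) : 0 <= c -> a <= b ->
  (forall t, 0 <= g t)%E ->
  (forall t, (a <= t <= b)%R -> (c * expR (t ^+ 2 / 2))%:E <= g t)%E ->
  ((c * ((b - a) / Num.sqrt (pi *+ 2)))%:E <= \int[gam]_t g t)%E.
Proof.
move=> c0 ab g0 gc.
pose f t := ((c * expR (t ^+ 2 / 2) * \1_`[a, b] t)%:E : \bar R).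
have f0 x : (0 <= f x)%E.
  by rewrite lee_fin !mulr_ge0// ?expR_ge0// indicE.
have mf : measurable_fun setT f.
  apply/measurable_EFinP; apply: measurable_funM; last exact: measurable_indic.
  apply: measurable_funM => //; apply: measurableT_comp => //.
  by apply: measurable_funM => //; exact: exprn_measurable.
apply: (@le_trans _ _ (\int[gam]_t f t)%E); last first.
  apply: le_integralT => // x; rewrite /f indicE.
  case: (boolP (_ \in _)) => [/[!inE]/=|_]; last by rewrite mulr0.
  by rewrite in_itv/= mulr1 => /gc.
rewrite integral_gam//.
rewrite (_ : (fun x => _) = (fun x : R =>
  (c * (Num.sqrt (pi *+ 2))^-1)%:E * (\1_`[a, b] x)%:E)%E); last first.
  apply/funext => x; rewrite -!EFinM normal_pdf01E; congr EFin.
  have -> : - x ^+ 2 / 2 = - (x ^+ 2 / 2) by rewrite mulNr.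
  rewrite expRN; have := expR_gt0 (x ^+ 2 / 2).
  by move: (expR _) => e e0; field; rewrite !gt_eqF// sqrtr_gt0 mulrn_wgt0// pi_gt0.
rewrite ge0_integralZl//; last 2 first.
  - exact/measurable_EFinP/measurable_indic.
  - by rewrite lee_fin mulr_ge0// invr_ge0.
rewrite integral_indic// setIT [X in (_ * X)%E](_ : _ = (b - a)%:E); last first.
  have := @lebesgue_measure_itv R `[a, b]; rewrite /= => ->.
  rewrite lte_fin -EFinB; case: ifPn => //.
  rewrite -leNgt => ba; rewrite (_ : b - a = 0)//.
  by apply/eqP; rewrite subr_eq0 eq_le ab ba.
by rewrite -EFinM lee_fin -mulrA (mulrC (b - a)) lexx.
Qed.

End gaussian_iteration.

(** * Finitely many independent Gaussian coordinates *)

Section coordinate_space.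
Context {R : realType} {I : finType}.
Notation gam := (normal_prob (0 : R) 1).

Definition box (B : I -> set R) : set (I -> R) := [set x | forall i, B i (x i)].

Definition boxes : set (set (I -> R)) :=
  [set box B | B in [set B | forall i, measurable (B i)]].

(** The product sigma-algebra. The generating boxes are stable under intersection, so a probability
    is determined by its values on them. *)
Definition coordT := g_sigma_algebraType boxes.

Lemma box_measurable (B : I -> set R) : (forall i, measurable (B i)) ->
  measurable (box B : set coordT).
Proof. by move=> mB; apply: sub_sigma_algebra; exists B. Qed.

Lemma measurable_to_coordT d (T : measurableType d) (f : T -> coordT) :
  (forall i, measurable_fun setT (fun x => f x i)) -> measurable_fun setT f.
Proof.
move=> mf; apply: (@measurability _ _ T coordT setT f boxes) => //.
move=> _ [_ [B mB <-] <-]; rewrite setTI.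
have -> : f @^-1` box B = \bigcap_(i in [set` [set: I]%SET])
    ((fun x => f x i) @^-1` B i).
  by apply/seteqP; split => [x fx i _|x fx i]; [exact: fx|apply: fx; rewrite /= inE].
apply: fin_bigcap_measurable => //.
by move=> i _; rewrite -[X in measurable X]setTI; exact: mf.
Qed.

Lemma measurable_coord (i : I) :
  measurable_fun setT ((fun x => x i) : coordT -> R).
Proof.
move=> _ B mB; rewrite setTI.
rewrite (_ : _ @^-1` _ = box (fun j => if j == i then B else setT)).
  by apply: box_measurable => j; case: ifP.
apply/seteqP; split => [x /= xi j|x /(_ i)]; last by rewrite eqxx.
by case: eqP => // ->.
Qed.

Definition upd (x : I -> R) (i : I) (t : R) : I -> R :=
  fun j => if j == i then t else x j.

Lemma upd_same x i t : upd x i t i = t.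
Proof. by rewrite /upd eqxx. Qed.

Lemma upd_other x i t j : j != i -> upd x i t j = x j.
Proof. by rewrite /upd => /negbTE ->. Qed.

Lemma updC x i t j r : i != j -> upd (upd x i t) j r = upd (upd x j r) i t.
Proof.
move=> ij; apply/funext => k; rewrite /upd.
by case: (k =P j) => // ->; rewrite eq_sym (negbTE ij).
Qed.

Lemma measurable_upd (i : I) :
  measurable_fun setT (fun z : measurableTypeR R * coordT => upd z.2 i z.1 : coordT).
Proof.
apply: measurable_to_coordT => j; rewrite /upd.
case: (j == i); first exact: measurable_fst.
exact: (measurableT_comp (measurable_coord j)).
Qed.

(* The probability of S when the coordinates listed in s are resampled as
   independent standard normal variables, the head of s being drawn first, and
   the other coordinates are those of x. *)
Fixpoint gprob (x : I -> R) (s : seq I) (S : set (I -> R)) : \bar R :=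
  if s is i :: s' then (\int[gam]_t gprob (upd x i t) s' S)%E
  else (\1_S x)%:E.

Lemma gprob_ge0 s x S : (0 <= gprob x s S)%E.
Proof.
elim: s x => [|i s IH] x /=; first by rewrite lee_fin indicE.
by apply: integral_ge0.
Qed.

Lemma gprob_upd s x i t S : i \notin s ->
  gprob (upd x i t) s S = gprob x s [set y | S (upd y i t)].
Proof.
elim: s x => [|j s IH] x //=; rewrite inE negb_or => /andP[ij ins].
apply: eq_integral => r _; rewrite updC// IH//.
Qed.

(** Induction on [s] from the Dirac mass at [x]: a new coordinate [i] is added by pushing the
    product of [gam] and [mu] forward along the update map. The first clause identifies the law, the
    second evaluates it as an iterated integral. *)
Lemma gprob_measure s x : uniq s -> exists mu : probability coordT R,
  (forall B, (forall i, measurable (B i)) ->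
     mu [set y | forall i, i \in s -> B i (y i)] = (\prod_(i <- s) gam (B i))%E)
  /\ (forall S, measurable S -> mu S = gprob x s S).
Proof.
elim: s => [_|i s IH /= /andP[ins us]].
  exists (dirac (x : coordT)); split; last by [].
  move=> B mB; rewrite big_nil/= diracE mem_set//.
have [mu [muB muS]] := IH us.
have mu_upd := measurable_upd i.
pose U : {mfun (measurableTypeR R * coordT)%type >-> coordT} :=
  HB.pack (fun z : measurableTypeR R * coordT => upd z.2 i z.1 : coordT)
    (isMeasurableFun.Build _ _ _ _ _ mu_upd).
pose P := [the probability _ _ of (gam \x mu)%E].
exists (distribution P U); split => [B mB|S mS].
  rewrite big_cons -muB// -(@product_measure1E _ _ _ _ _ gam mu); last 2 first.
  - exact: mB.
  - rewrite (_ : [set y | _] = box (fun j => if j \in s then B j else setT)); last first.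
      apply/seteqP; split => y /= yB j; first by case: ifPn => // /yB.
      by move=> js; have := yB j; rewrite js.
    by apply: box_measurable => j; case: ifP.
  rewrite /distribution /pushforward/=; apply: (congr1 (product_measure1 gam mu)).
  apply/seteqP; split => -[t y]/= tyB.
    split; first by have := tyB i; rewrite inE eqxx upd_same; apply.
    move=> j js; have := tyB j; rewrite inE js orbT upd_other; first exact.
    by apply: contraNneq ins => <-.
  move=> j; rewrite inE /upd; case: eqP => [->|_] /= js; first exact: tyB.1.
  exact: tyB.2.
rewrite /distribution /pushforward/= /P/= /product_measure1/=.
apply: eq_integral => t _; rewrite gprob_upd// -muS; last first.
  have := measurableT_comp mu_upd (pair1_measurable t) measurableT mS.
  by rewrite setTI.
by congr (mu _); apply/seteqP; split => y /=; rewrite /xsection/= inE.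
Qed.

(** Independence over all of [I] gives both laws the same values on boxes, a generating pi-system.
    Any enumeration [s] of the coordinates is allowed, so the order of integration can be adapted to
    the event. *)
Lemma law_gprob d (Omega : measurableType d) (P : probability Omega R)
    (X : I -> Omega -> R) x s S : uniq s -> (forall i, i \in s) ->
  (forall i, measurable_fun setT (X i)) ->
  (forall i (B : set R), measurable B -> P (X i @^-1` B) = gam B) ->
  mutually_independent P X -> measurable (S : set coordT) ->
  P [set w | S (X ^~ w)] = gprob x s S.
Proof.
move=> us sI mX XE indep mS.
have [mu [muB muS]] := gprob_measure x us.
have mX' : measurable_fun setT (fun w => X ^~ w : coordT).
  exact: measurable_to_coordT.
pose U : {mfun Omega >-> coordT} := HB.pack (fun w => X ^~ w : coordT)
    (isMeasurableFun.Build _ _ _ _ _ mX').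
rewrite -muS//; rewrite (_ : P _ = distribution P U S)//.
apply: (@measure_unique _ R coordT boxes (fun=> setT)) => //.
- move=> _ _ [B mB <-] [C mC <-]; exists (fun i => B i `&` C i).
    by move=> i; exact: measurableI.
  apply/seteqP; split => [y BC|y [By Cy] i]; first by split=> i; have [] := BC i.
  by split.
- by move=> _; exists (fun=> setT) => //; apply/seteqP; split.
- by rewrite bigcup_const.
- move=> _ [B mB <-]; have := muB B mB.
  rewrite (_ : [set y | _] = box B); last first.
    by apply/seteqP; split => y /= yB i => [|_]; apply: yB.
  move=> muBE; apply: etrans (esym muBE).
  have := indep [set: I]%SET B mB.
  rewrite (_ : \bigcap_(i in _) _ = [set w | box B (X ^~ w)]); last first.
    apply/seteqP; split => w /= wB i; last by move=> _; exact: wB.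
    by apply: wB; rewrite /= inE.
  move=> indepB; apply: etrans indepB _.
  rewrite (eq_bigr (fun i => gam (B i))); last by move=> i _; exact: XE.
  rewrite (eq_bigl xpredT); last by move=> i; rewrite inE.
  apply: perm_big; apply: uniq_perm => //; first exact: index_enum_uniq.
  by move=> i; rewrite mem_index_enum sI.
- by move=> _; rewrite (le_lt_trans (probability_le1 _ _))// ltry.
Qed.

End coordinate_space.

(** * Gaussian probability of a slab *)

Section gaussian_slab.
Context {R : realType}.
Notation gam := (normal_prob (0 : R) 1).
Notation mu := (@lebesgue_measure R).
Implicit Types m s y : R.

Lemma normal_pdf_affine m s x : 0 < s ->
  normal_pdf m s x = normal_pdf 0 1 ((x - m) / s) * s^-1.
Proof.
move=> s0; have sn0 : s != 0 by rewrite gt_eqF.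
rewrite normal_pdf01E normal_pdfE// /normal_peak /normal_fun.
rewrite -[RHS]mulrAC; congr (_ * _); last by congr expR; field.
rewrite -(mulrnAr (s ^+ 2)) sqrtrM ?sqr_ge0// sqrtr_sqr gtr0_norm//.
by rewrite invfM mulrC.
Qed.

Lemma gam_slab_pos m s : 0 < s ->
  gam [set t | -1 <= m + s * t <= 1] = normal_prob m s `[-1, 1]%classic.
Proof.
move=> s0; have sn0 : s != 0 by rewrite gt_eqF.
pose F x : R := (x - m) / s.
have F'E : F^`()%classic = cst s^-1.
  apply/funext => x; rewrite /F derive1E deriveM// deriveD// derive_cst scaler0.
  by rewrite add0r derive_id derive_cst addr0 /GRing.scale/= mulr1.
have -> : [set t | -1 <= m + s * t <= 1] = `[F (-1), F 1]%classic.
  apply/seteqP; split => t; rewrite /= in_itv/= /F ler_pdivrMr// ler_pdivlMr//.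
    by move=> /andP[h1 h2]; apply/andP; split; lra.
  by move=> /andP[h1 h2]; apply/andP; split; lra.
rewrite /normal_prob integration_by_substitution_increasing//.
- by apply: eq_integral => x _; rewrite F'E normal_pdf_affine.
- by move=> x y _ _ xy; rewrite /F ltr_pM2r ?invr_gt0// ltrD2r.
- by rewrite F'E => ? _; exact: cvg_cst.
- by rewrite F'E; exact: is_cvg_cst.
- by rewrite F'E; exact: is_cvg_cst.
- split.
  + by move=> x _; rewrite /F.
  + apply: cvg_at_right_filter; apply: cvgM; last exact: cvg_cst.
    by apply: cvgB; [exact: cvg_id|exact: cvg_cst].
  + apply: cvg_at_left_filter; apply: cvgM; last exact: cvg_cst.
    by apply: cvgB; [exact: cvg_id|exact: cvg_cst].
- by apply: continuous_subspaceT; apply: continuous_normal_pdf; rewrite oner_eq0.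
Qed.

Lemma gam_opp (a : R) : gam `]-oo, (- a)]%classic = gam `[a, +oo[%classic.
Proof.
rewrite /normal_prob ge0_integration_by_substitutionNy.
- apply: eq_integral => x _; congr EFin => /=.
  by rewrite !normal_pdf01E sqrrN.
- by apply: continuous_subspaceT; apply: continuous_normal_pdf; rewrite oner_eq0.
- by move=> x _; exact: normal_pdf_ge0.
Qed.


(* Completing the square in r. *)
Lemma normal_pdf_mul m s y r x : 0 < s ->
  normal_pdf 0 1 r * normal_pdf (m + y * r) s x =
  normal_pdf m (Num.sqrt (s ^+ 2 + y ^+ 2)) x *
  normal_pdf (y * (x - m) / (s ^+ 2 + y ^+ 2))
    (s / Num.sqrt (s ^+ 2 + y ^+ 2)) r.
Proof.
move=> s0; set T := s ^+ 2 + y ^+ 2; set t := Num.sqrt T.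
have T0 : 0 < T by rewrite ltr_pwDl ?exprn_gt0 ?sqr_ge0.
have t0 : 0 < t by rewrite sqrtr_gt0.
have tT : t ^+ 2 = T by rewrite sqr_sqrtr ?ltW.
have st0 : 0 < s / t by rewrite divr_gt0.
rewrite (normal_pdf_affine _ _ s0) (normal_pdf_affine _ _ t0).
rewrite (normal_pdf_affine _ _ st0) !normal_pdf01E.
set k := (Num.sqrt _)^-1.
have E : expR (- r ^+ 2 / 2) * expR (- ((x - (m + y * r)) / s) ^+ 2 / 2) =
    expR (- ((x - m) / t) ^+ 2 / 2) *
    expR (- ((r - y * (x - m) / T) / (s / t)) ^+ 2 / 2).
  rewrite -!expRD; congr expR; rewrite !expr_div_n tT.
  by rewrite /T; field; rewrite !gt_eqF.
transitivity (k ^+ 2 * s^-1 *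
  (expR (- r ^+ 2 / 2) * expR (- ((x - (m + y * r)) / s) ^+ 2 / 2))).
  by ring.
by rewrite E; field; rewrite !gt_eqF.
Qed.

Lemma measurable_normal_pdf_affine y m s : 0 < s ->
  measurable_fun setT
    (fun z : measurableTypeR R * measurableTypeR R =>
       normal_pdf (m + y * z.1) s z.2).
Proof.
move=> s0; rewrite (_ : (fun _ => _) =
    (fun z => normal_pdf 0 s (z.2 - (m + y * z.1)))).
  apply: measurableT_comp; first exact: measurable_normal_pdf.
  apply: measurable_funB => //; apply: measurable_funD => //.
  by apply: measurable_funM.
by apply/funext => z; rewrite !normal_pdfE ?gt_eqF// /normal_fun subr0.
Qed.

Lemma measurable_normal_prob_affine m s y (B : set R) : measurable B -> 0 < s ->
  measurable_fun setT (fun r : measurableTypeR R => normal_prob (m + y * r) s B).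
Proof.
move=> mB s0.
pose g (z : measurableTypeR R * measurableTypeR R) : \bar R :=
  (normal_pdf (m + y * z.1) s z.2 * \1_B z.2)%:E.
have mg : measurable_fun setT g.
  apply/measurable_EFinP; apply: measurable_funM.
    exact: measurable_normal_pdf_affine.
  by apply: measurableT_comp => //; exact: measurable_indic.
have g0 z : (0 <= g z)%E by rewrite lee_fin mulr_ge0 ?normal_pdf_ge0// indicE.
have := @measurable_fun_fubini_tonelli_F _ _ _ _ R mu g mg g0.
congr measurable_fun; apply/funext => r.
rewrite /fubini_F /normal_prob [RHS]integral_mkcond; apply: eq_integral => x _.
by rewrite patchE /g/= indicE; case: ifPn => xB; rewrite ?mulr1 ?mulr0.
Qed.

(** By Tonelli the integral over [r] is taken first. By [normal_pdf_mul] its integrand is a factor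
    free of [r] times a normal density in [r], of integral 1. *)
Lemma normal_prob_conv m s y (B : set R) : measurable B -> 0 < s ->
  (\int[gam]_r normal_prob (m + (y * r)%R)%R s B =
   normal_prob m (Num.sqrt (s ^+ 2 + y ^+ 2)%R) B)%E.
Proof.
move=> mB s0.
pose f (z : measurableTypeR R * measurableTypeR R) : \bar R :=
  ((normal_pdf 0 1 z.1 * normal_pdf (m + y * z.1) s z.2)%R * \1_B z.2)%:E.
have f0 z : (0 <= f z)%E.
  by rewrite lee_fin !mulr_ge0 ?normal_pdf_ge0// indicE.
have mf : measurable_fun setT f.
  apply/measurable_EFinP; apply: measurable_funM; last first.
    by apply: measurableT_comp => //; exact: measurable_indic.
  apply: measurable_funM; last exact: measurable_normal_pdf_affine.
  by apply: measurableT_comp => //; exact: measurable_normal_pdf.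
have T0 : 0 < s ^+ 2 + y ^+ 2 by rewrite ltr_pwDl ?exprn_gt0 ?sqr_ge0.
have := @fubini_tonelli _ _ _ _ R mu mu f mf f0; rewrite /fubini_F /fubini_G => fub.
transitivity (\int[mu]_r \int[mu]_x f (r, x))%E.
  rewrite integral_gam.
  - apply: eq_integral => r _; rewrite /normal_prob muleC -ge0_integralZl//.
    + rewrite integral_mkcond; apply: eq_integral => x _.
      rewrite patchE /f/= indicE; case: ifPn => xB; last by rewrite mulr0.
      by rewrite mulr1 EFinM.
    + apply/measurable_EFinP; apply: measurable_funTS.
      exact: measurable_normal_pdf.
    + by move=> x _; rewrite lee_fin normal_pdf_ge0.
    + by rewrite lee_fin normal_pdf_ge0.
  - exact: measurable_normal_prob_affine.
  - by move=> r; exact: measure_ge0.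
rewrite fub /normal_prob [RHS]integral_mkcond; apply: eq_integral => x _.
rewrite patchE /f/=; case: ifPn => xB; last first.
  by rewrite integral0_eq// => r _; rewrite indicE (negbTE xB) mulr0.
transitivity (\int[mu]_r ((normal_pdf m (Num.sqrt (s ^+ 2 + y ^+ 2)) x)%:E *
  (normal_pdf (y * (x - m) / (s ^+ 2 + y ^+ 2))
    (s / Num.sqrt (s ^+ 2 + y ^+ 2)) r)%:E))%E.
  by apply: eq_integral => r _; rewrite indicE xB mulr1 normal_pdf_mul// EFinM.
rewrite ge0_integralZl//.
- by rewrite integral_normal_pdf mule1.
- by apply/measurable_EFinP; exact: measurable_normal_pdf.
- by move=> r _; rewrite lee_fin normal_pdf_ge0.
- by rewrite lee_fin normal_pdf_ge0.
Qed.


(** Written through a standard normal variable so that [s = 0] gives the point mass at [m], where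
    the induction over the entries of a row starts. *)
Definition slab s m : \bar R := gam [set t | -1 <= m + s * t <= 1].

Lemma slab_ge0 s m : (0 <= slab s m)%E.
Proof. exact: measure_ge0. Qed.

Lemma slab0E m : slab 0 m = (\1_`[-1, 1] m)%:E.
Proof.
rewrite /slab indicE mem_setE in_itv/=.
have [mP|mP] := boolP (-1 <= m <= 1).
  rewrite (_ : [set t | _] = setT) ?probability_setT//.
  by apply/seteqP; split => t //=; rewrite mul0r addr0.
rewrite (_ : [set t | _] = set0) ?measure0//.
by apply/seteqP; split => t //=; rewrite mul0r addr0 (negbTE mP).
Qed.

Lemma slab_pos s m : 0 < s -> slab s m = normal_prob m s `[-1, 1]%classic.
Proof. exact: gam_slab_pos. Qed.

(** Symmetry of the standard normal law, by the substitution of [- t] for [t]. *)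
Lemma slab_abs s m : slab `|s| m = slab s m.
Proof.
have [s0|s0] := leP 0 s; first by rewrite ger0_norm.
rewrite ltr0_norm//.
have s0' : 0 < - s by rewrite oppr_gt0.
pose a := (- 1 - m) / - s; pose b := (1 - m) / - s.
rewrite /slab (_ : [set t | _] = `[a, b]%classic); last first.
  apply/seteqP; split => t; rewrite /= in_itv/= ler_pdivrMr// ler_pdivlMr//.
    by move=> /andP[h1 h2]; apply/andP; split; lra.
  by move=> /andP[h1 h2]; apply/andP; split; lra.
rewrite (_ : [set t | -1 <= m + s * t <= 1] = `[- b, - a]%classic); last first.
  apply/seteqP; split => t; rewrite /= in_itv/= => /andP[h1 h2].
    apply/andP; split; first by rewrite lerNl ler_pdivlMr//; lra.
    by rewrite lerNr ler_pdivrMr//; lra.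
  move: h1 h2; rewrite lerNl lerNr ler_pdivlMr// ler_pdivrMr// => h1 h2.
  by apply/andP; split; lra.
rewrite /normal_prob integration_by_substitution_oppr.
- apply: eq_integral => x _; congr EFin => /=.
  by rewrite !normal_pdf01E sqrrN.
- by rewrite /a /b ler_pM2r ?invr_gt0//; lra.
- by apply: continuous_subspaceT; apply: continuous_normal_pdf; rewrite oner_eq0.
Qed.

Lemma measurable_slab s m y : 0 <= s ->
  measurable_fun setT (fun r : measurableTypeR R => slab s (m + y * r)).
Proof.
rewrite le_eqVlt => /predU1P[<-|s0].
  rewrite (_ : (fun r => _) = fun r => (\1_`[-1, 1] (m + y * r))%:E).
    apply/measurable_EFinP; apply: measurableT_comp; first exact: measurable_indic.
    by apply: measurable_funD => //; apply: measurable_funM.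
  by apply/funext => r; rewrite slab0E.
rewrite (_ : (fun r => _) = fun r => normal_prob (m + y * r) s `[-1, 1]%classic).
  exact: measurable_normal_prob_affine.
by apply/funext => r; exact: slab_pos.
Qed.

(** The variances of independent terms add. The point mass [s = 0] has no density and is treated
    apart. *)
Lemma slab_conv s m y : 0 <= s ->
  (\int[gam]_r slab s (m + (y * r)%R)%R =
   slab (Num.sqrt (s ^+ 2 + y ^+ 2)%R) m)%E.
Proof.
rewrite le_eqVlt => /predU1P[<-|s0].
  rewrite expr0n/= add0r sqrtr_sqr slab_abs.
  transitivity (\int[gam]_r (\1_[set t | (-1 <= m + y * t <= 1)%R] r)%:E)%E.
    apply: eq_integral => r _; rewrite slab0E !indicE mem_setE in_itv/=.
    by congr ((nat_of_bool _)%:R%:E); apply/idP/idP => [?|/set_mem//]; exact/mem_set.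
  rewrite integral_indic ?setIT//.
  rewrite (_ : [set t | _] = (fun t => m + y * t) @^-1` `[-1, 1]%classic).
    rewrite -[X in measurable X]setTI.
    have : measurable_fun setT (fun t : measurableTypeR R => m + y * t).
      by apply: measurable_funD => //; apply: measurable_funM.
    by apply.
  by apply/seteqP; split => t; rewrite /= in_itv.
have T0 : 0 < s ^+ 2 + y ^+ 2 by rewrite ltr_pwDl ?exprn_gt0 ?sqr_ge0.
have t0 : 0 < Num.sqrt (s ^+ 2 + y ^+ 2) by rewrite sqrtr_gt0.
have mB : measurable (`[-1, 1]%classic : set R) by [].
rewrite (slab_pos m t0); apply: etrans (normal_prob_conv m y mB s0).
by apply: eq_integral => r _; exact: slab_pos.
Qed.

(** Since [(x - h) ^+ 2 >= 0], the density is at most [exp(h^2/2 - h x)] over [sqrt(2 pi)], and this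
    exponential has an explicit primitive. The factor 1/2 comes from [pi >= 2]. *)
Lemma gam_tail h : 0 < h ->
  (gam `[h, +oo[%classic <= (expR (- h ^+ 2 / 2) / (2 * h))%:E)%E.
Proof.
move=> h0.
have expE : (\int[mu]_(x in `[h, +oo[) (h * expR (- h * x))%:E =
    (expR (- h ^+ 2))%:E)%E.
  have cexp : continuous (fun z : R^o => expR (- h * z)).
    move=> z; apply: continuous_comp; last exact: continuous_expR.
    by apply: continuousM => //; exact: cst_continuous.
  rewrite (@ge0_continuous_FTC2y _ _ (fun x => - (expR (- h * x))) _ 0)//.
  - by rewrite EFinN oppeK add0e mulNr expr2.
  - by move=> x _; rewrite mulr_ge0 ?expR_ge0// ltW.
  - apply: continuous_subspaceT => x; apply: cvgM; last exact: cexp.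
    exact: cvg_cst.
  - rewrite -oppr0; apply: cvgN.
    rewrite (_ : (fun x => expR (- h * x)) =
                 (fun z => expR (- z)) \o (fun z => h * z)); last first.
      by apply: eq_fun => x; rewrite mulNr.
    apply: (@cvg_comp _ _ _ _ _ _ (pinfty_nbhs R)); last exact: cvgr_expR.
    exact: gt0_cvgMry.
  - by apply: cvgN; apply/cvg_at_right_filter; exact: cexp.
  - move=> z _.
    rewrite derive1_comp// derive1N// derive1_id mulN1r derive1_comp// derive1E.
    have /funeqP -> := @derive_expR R.
    by rewrite derive1Ml// derive1_id mulr1 mulrN opprK mulrC.
pose k := (Num.sqrt (pi *+ 2) : R)^-1.
have k0 : 0 <= k by rewrite invr_ge0.
have k2 : k <= 2^-1.
  have pi2 := pi_ge2 R.
  have t0 : 0 <= pi *+ 2 :> R by rewrite mulrn_wge0// pi_ge0.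
  have tt : 2 <= Num.sqrt (pi *+ 2) :> R.
    rewrite -(@ler_pXn2r _ 2) ?nnegrE ?sqrtr_ge0// sqr_sqrtr//.
    by rewrite -mulr_natr; lra.
  by rewrite lef_pV2 ?posrE// (lt_le_trans _ tt).
have : (gam `[h, +oo[%classic <= \int[mu]_(x in `[h, +oo[)
    ((k * expR (h ^+ 2 / 2) / h)%:E * (h * expR (- h * x))%:E))%E.
  apply: ge0_le_integral => //.
  - by move=> x _; rewrite lee_fin normal_pdf_ge0.
  - apply/measurable_EFinP; apply: measurable_funTS; exact: measurable_normal_pdf.
  - apply/measurable_EFinP; apply: measurable_funTS.
    apply: measurable_funM => //; apply: measurable_funM => //.
    by apply: measurableT_comp => //; apply: measurable_funM.
  - move=> x _; rewrite -EFinM lee_fin normal_pdf01E -/k.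
    rewrite (_ : _ * (h * _) = k * (expR (h ^+ 2 / 2) * expR (- h * x))); last first.
      by field; rewrite gt_eqF.
    rewrite ler_wpM2l// -expRD ler_expR.
    by have := sqr_ge0 (x - h); rewrite sqrrB; lra.
move=> /le_trans; apply; rewrite ge0_integralZl//; first last.
- by rewrite lee_fin !mulr_ge0// ?expR_ge0// invr_ge0 ltW.
- by move=> x _; rewrite lee_fin mulr_ge0 ?expR_ge0// ltW.
- apply/measurable_EFinP; apply: measurable_funTS; apply: measurable_funM => //.
  by apply: measurableT_comp => //; apply: measurable_funM.
rewrite expE -EFinM lee_fin.
rewrite (_ : k * expR (h ^+ 2 / 2) / h * expR (- h ^+ 2) =
  k * (expR (h ^+ 2 / 2) * expR (- h ^+ 2)) / h); last first.
  by field; rewrite gt_eqF.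
rewrite -expRD (_ : h ^+ 2 / 2 + - h ^+ 2 = - h ^+ 2 / 2); last by field.
set E := expR _; rewrite (_ : E / (2 * h) = 2^-1 * E / h); last first.
  by field; rewrite gt_eqF.
by rewrite ler_wpM2r ?invr_ge0 ?(ltW h0)// ler_wpM2r ?expR_ge0.
Qed.

(** As [s * h <= 1], leaving the slab forces [t] into one of the half-lines beyond [h] and [- h],
    and [gam_tail] bounds each of them. *)
Lemma slab_tail s h : 0 < h -> 0 <= s -> s * h <= 1 ->
  ((1 - expR (- h ^+ 2 / 2) / h)%:E <= slab s 0)%E.
Proof.
move=> h0 s0 sh.
have mL : measurable (`]-oo, - h]%classic : set R) by [].
have mU : measurable (`[h, +oo[%classic : set R) by [].
have mS : measurable [set t : R | -1 <= 0 + s * t <= 1].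
  rewrite (_ : [set t | _] = (fun t => 0 + s * t) @^-1` `[-1, 1]%classic).
    rewrite -[X in measurable X]setTI.
    have : measurable_fun setT (fun t : measurableTypeR R => 0 + s * t).
      by apply: measurable_funD => //; apply: measurable_funM.
    by apply.
  by apply/seteqP; split => t; rewrite /= in_itv.
have : (1%:E <= slab s 0 + ((expR (- h ^+ 2 / 2) / (2 * h))%:E +
    (expR (- h ^+ 2 / 2) / (2 * h))%:E))%E.
  rewrite -(@probability_setT _ _ R gam).
  apply: (@le_trans _ _ (gam ([set t | (-1 <= 0 + s * t <= 1)%R] `|`
    (`]-oo, - h]%classic `|` `[h, +oo[%classic)))).
    apply: le_measure; rewrite ?inE//.
      by apply: measurableU => //; exact: measurableU.
    move=> t _; have [ht|ht] := leP h t.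
      by right; right; rewrite /= in_itv/= ht.
    have [ht'|ht'] := leP t (- h); first by right; left; rewrite /= in_itv/=.
    left => /=; rewrite add0r; apply/andP; split.
      have : s * (- h) <= s * t by rewrite ler_wpM2l// ltW.
      by rewrite mulrN; lra.
    by apply: (le_trans _ sh); rewrite ler_wpM2l// ltW.
  apply: le_trans (measureU2 _ _ _) _ => //; first exact: measurableU.
  rewrite leeD2l//; apply: le_trans (measureU2 _ _ _) _ => //.
  apply: leeD; last exact: gam_tail.
  by apply: le_trans (gam_tail h0); rewrite -(gam_opp h).
rewrite -EFinD -leeBlDr// -EFinB; apply: le_trans; rewrite lee_fin.
by rewrite le_eqVlt; apply/orP; left; apply/eqP; field; rewrite gt_eqF.
Qed.

End gaussian_slab.

(** * Lower bounds on the probability of events in many coordinates *)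

Section gprob_lower_bounds.
Context {R : realType} {I : finType}.
Notation gam := (normal_prob (0 : R) 1).
Implicit Types (x y : I -> R) (s r : seq I) (S : set (I -> R)).

(** The inverse densities of all coordinates of [s] are collected in the hypothesis rather than
    bounded one by one, because only the squared norm of a whole row is controlled later. *)
Lemma gprob_box_ge s r x S (lo hi : I -> R) c : uniq s -> 0 <= c ->
  (forall i, i \in s -> lo i <= hi i) ->
  (forall y, (forall j, j \notin s -> y j = x j) ->
     (forall i, i \in s -> lo i <= y i <= hi i) ->
     ((c * \prod_(i <- s) expR (y i ^+ 2 / 2))%:E <= gprob y r S)%E) ->
  ((c * \prod_(i <- s) ((hi i - lo i) / Num.sqrt (pi *+ 2)))%:E <=
     gprob x (s ++ r) S)%E.
Proof.
elim: s x c => [|i s IH] x c /=.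
  by move=> _ _ _ /(_ x) H; rewrite !big_nil in H *; apply: H.
move=> /andP[ins us] c0 lohi H.
have lohi' j : j \in s -> lo j <= hi j.
  by move=> js; apply: lohi; rewrite inE js orbT.
rewrite big_cons mulrCA mulrC.
apply: integral_gam_ge.
- rewrite mulr_ge0// big_seq prodr_ge0// => j js.
  by rewrite divr_ge0// subr_ge0 lohi'.
- by apply: lohi; rewrite inE eqxx.
- by move=> t; exact: gprob_ge0.
move=> t tI; rewrite mulrAC; apply: IH => //.
  by rewrite mulr_ge0// expR_ge0.
move=> y yx yI.
have yit : y i = t by rewrite yx// upd_same.
have := H y; rewrite big_cons yit mulrA; apply.
  move=> j; rewrite inE negb_or => /andP[ji js].
  by rewrite yx// upd_other.
move=> j; rewrite inE => /predU1P[->|]; last exact: yI.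
by rewrite yit.
Qed.

(** The entries in [s] range over a box, and the entry [i0] over an interval that depends on them.
    Since [Q] bounds the squared norm of the row, its density is at least [exp(-Q/2)] up to powers
    of [sqrt(2 pi)]. *)
Lemma gprob_row_ge s i0 r x S (lo hi : I -> R) (a b : (I -> R) -> R) lam Q c :
  uniq s -> 0 <= c -> 0 <= lam ->
  (forall i, i \in s -> lo i <= hi i) ->
  (forall y, (forall j, j \notin s -> y j = x j) ->
     (forall i, i \in s -> lo i <= y i <= hi i) ->
     lam <= b y - a y /\
     forall t, a y <= t <= b y ->
       \sum_(i <- s) y i ^+ 2 + t ^+ 2 <= Q /\
       (c%:E <= gprob (upd y i0 t) r S)%E) ->
  ((c * expR (- Q / 2) * (lam / Num.sqrt (pi *+ 2)) *
     \prod_(i <- s) ((hi i - lo i) / Num.sqrt (pi *+ 2)))%:E <=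
     gprob x (s ++ i0 :: r) S)%E.
Proof.
move=> us c0 lam0 lohi H.
have s0 : 0 <= (Num.sqrt (pi *+ 2) : R)^-1 by rewrite invr_ge0.
apply: gprob_box_ge => //; first by rewrite !mulr_ge0// expR_ge0.
move=> y yx yI; have [lamab Hy] := H y yx yI.
set p := \prod_(i <- s) _.
have p0 : 0 <= p by rewrite prodr_ge0// => i _; exact: expR_ge0.
apply: (@le_trans _ _ (c * expR (- Q / 2) * p *
  ((b y - a y) / Num.sqrt (pi *+ 2)))%:E).
  rewrite lee_fin mulrAC ler_wpM2l ?mulr_ge0 ?expR_ge0//.
  by rewrite ler_wpM2r.
apply: integral_gam_ge.
- by rewrite !mulr_ge0 ?expR_ge0.
- by rewrite -subr_ge0 (le_trans lam0).
- by move=> t; exact: gprob_ge0.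
move=> t tab; have [tQ] := Hy t tab; apply: le_trans.
rewrite lee_fin -mulrA -mulrA -[leRHS]mulr1 ler_wpM2l//.
have -> : p = expR (\sum_(i <- s) y i ^+ 2 / 2) by rewrite expR_sum.
rewrite -!expRD -[leRHS]expR0 ler_expR -mulr_suml; lra.
Qed.

(** Once drawn, the head of [s] moves into the mean [m]; integrating over it, [slab_conv] adds its
    variance back. *)
Lemma gprob_slab_ge s r x S (coef : I -> R) c m : uniq s -> 0 <= c ->
  (forall y, (forall j, j \notin s -> y j = x j) ->
     -1 <= m + \sum_(i <- s) coef i * y i <= 1 -> (c%:E <= gprob y r S)%E) ->
  (c%:E * slab (Num.sqrt (\sum_(i <- s) coef i ^+ 2)%R) m <=
     gprob x (s ++ r) S)%E.
Proof.
elim: s x m => [|i s IH] x m /=.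
  move=> _ c0 /(_ x); rewrite !big_nil sqrtr0 addr0 slab0E indicE mem_setE in_itv/=.
  case: (boolP (-1 <= m <= 1)) => [_ H|_ _]; first by rewrite mule1; exact: H.
  by rewrite mule0; exact: gprob_ge0.
move=> /andP[ins us] c0 H.
set sg := Num.sqrt (\sum_(j <- s) coef j ^+ 2).
have sg0 : 0 <= sg := sqrtr_ge0 _.
have -> : Num.sqrt (\sum_(j <- i :: s) coef j ^+ 2) =
    Num.sqrt (sg ^+ 2 + coef i ^+ 2).
  by rewrite big_cons sqr_sqrtr 1?addrC// sumr_ge0// => j _; exact: sqr_ge0.
rewrite -slab_conv// -ge0_integralZl//; last first.
  exact: measurable_slab.
apply: le_integralT => t; first by rewrite mule_ge0// slab_ge0.
apply: IH => // y yx yS; apply: H.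
  move=> j; rewrite inE negb_or => /andP[ji js].
  by rewrite yx// upd_other.
by rewrite big_cons yx// upd_same addrA.
Qed.

End gprob_lower_bounds.

(** * Short solutions of the top system *)

Section diagonal_dominance.
Context {R : realFieldType} {n : nat}.
Variable M : 'M[R]_n.
Hypothesis M_dom : forall k, \sum_l `|M k l - (k == l)%:R| <= 2^-1.

(** At an index [k] where [|v_k|] is maximal, [|v_k| <= rho + |v_k| / 2]. *)
Lemma diag_dominant_bound (v : 'cV[R]_n) (rho : R) :
  (forall k, `|(M *m v) k 0| <= rho) -> forall l, `|v l 0| <= 2 * rho.
Proof.
move=> vrho l.
have [k _ kmax] := @Order.TotalTheory.arg_maxP _ _ _ l xpredT
  (fun l => `|v l 0|) isT.
apply: (le_trans (kmax l isT)).
have vk : v k 0 = (M *m v) k 0 - \sum_l (M k l - (k == l)%:R) * v l 0.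
  rewrite mxE -sumrB (bigD1 k)//= eqxx big1 => [|j jk] /=.
    by rewrite addr0 mulr1n; ring.
  by rewrite eq_sym (negbTE jk) mulr0n; ring.
have : `|\sum_l (M k l - (k == l)%:R) * v l 0| <= 2^-1 * `|v k 0|.
  apply: le_trans (ler_norm_sum _ _ _) _.
  apply: (@le_trans _ _ (\sum_l `|M k l - (k == l)%:R| * `|v k 0|)).
    by apply: ler_sum => j _; rewrite normrM ler_wpM2l//; exact: kmax.
  by rewrite -mulr_suml ler_wpM2r.
have := vrho k; have := ler_normB ((M *m v) k 0)
  (\sum_l (M k l - (k == l)%:R) * v l 0); rewrite -vk.
by move=> /= h1 h2 h3; lra.
Qed.

(** The preceding bound with [rho = 0] makes [M] injective, hence invertible. *)
Lemma diag_dominant_solve (r : 'cV[R]_n) (rho : R) :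
  (forall k, `|r k 0| <= rho) ->
  exists2 v : 'cV[R]_n, M *m v = r & forall l, `|v l 0| <= 2 * rho.
Proof.
move=> rrho.
have Mu : M \in unitmx.
  rewrite -unitmx_tr -row_free_unit; apply: inj_row_free => u uM.
  have Mu0 : M *m u^T = 0 by apply: trmx_inj; rewrite trmx_mul trmxK uM trmx0.
  apply/rowP => j; rewrite mxE; apply/eqP; rewrite -normr_le0.
  have := @diag_dominant_bound u^T 0 _ j; rewrite mulr0 mxE; apply => k.
  by rewrite Mu0 mxE normr0.
exists (invmx M *m r); first by rewrite mulmxA mulmxV// mul1mx.
by apply: diag_dominant_bound => k; rewrite mulmxA mulmxV// mul1mx.
Qed.

End diagonal_dominance.

Section short_solution.
Context {R : realFieldType} {de d : nat} (le_de_d : (de <= d)%N).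
Let col (k : 'I_de) : 'I_d := widen_ord le_de_d k.

Let col_inj : injective col.
Proof. by move=> i j /(congr1 val) /= ij; apply: val_inj. Qed.

Variables (A : 'I_de -> 'I_d -> R) (k0 : 'I_de) (s z : 'I_de -> R) (eps h : R).
Let a l := A k0 l.
Let x k l := A k l - s k * a l.
Let L2 := \sum_l a l ^+ 2.

Hypothesis eps0 : 0 < eps.
Hypothesis d_eps : d%:R * eps <= 6^-1.
Hypothesis h0 : 0 < h.
Hypothesis a_large : 1 <= a (col k0) * eps.
Hypothesis a_small : forall l, l != col k0 -> `|a l| <= eps * a (col k0).
Hypothesis L2h : h ^+ 2 + 4 * d%:R <= L2.
Hypothesis x_close : forall k l, k != k0 -> l != col k0 ->
  `|x k l - (l == col k)%:R| <= eps.
Hypothesis x_orth : forall k, k != k0 -> `|\sum_l x k l * a l| <= 1.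
Hypothesis z_max : `|z k0| <= 1.
Hypothesis zE : forall k, k != k0 -> z k = s k * z k0.

(** Off the pivot column the terms of [x_k . a] sum to at most [2 eps al], where [al] is the pivot
    entry of [a]. The whole sum is at most 1 and [1 <= eps al], so the pivot term is at most
    [3 eps al]. *)
Lemma x_pivot_small k : k != k0 -> `|x k (col k0)| <= 3 * eps.
Proof.
move=> kk0; set al := a (col k0).
have al0 : 0 < al by rewrite -(pmulr_lgt0 _ eps0) (lt_le_trans ltr01).
have := x_orth kk0; rewrite (bigD1 (col k0))//= -/al.
set W := \sum_(l | _) _ => xW.
have Wle : `|W| <= 2 * eps * al.
  apply: le_trans (ler_norm_sum _ _ _) _.
  apply: (@le_trans _ _ (\sum_(l | l != col k0)
      (eps + (l == col k)%:R) * (eps * al))).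
    apply: ler_sum => l lk0; rewrite normrM.
    apply: ler_pM => //; last exact: a_small.
    have := x_close kk0 lk0; set b := (_ == _)%:R => xb.
    have b0 : 0 <= b by rewrite ler0n.
    have := ler_normD (x k l - b) b; rewrite subrK (ger0_norm b0).
    by move=> /le_trans; apply; rewrite lerD2r.
  rewrite -mulr_suml -[leRHS]mulrA ler_wpM2r ?mulr_ge0 ?(ltW eps0) ?(ltW al0)//.
  apply: (@le_trans _ _ (\sum_l (eps + (l == col k)%:R))).
    rewrite [leRHS](bigD1 (col k0))//= lerDr addr_ge0 ?(ltW eps0)//.
  rewrite big_split/= sumr_const card_ord.
  rewrite (bigD1 (col k))//= eqxx big1 => [|l /negbTE ->//].
  by rewrite addr0 -mulr_natl mulr1n; move: d_eps; lra.
have e1 : `|x k (col k0) * al| <= 1 + 2 * eps * al.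
  have := ler_normB (x k (col k0) * al + W) W; rewrite addrK.
  by move: Wle xW; lra.
rewrite -(ler_pM2r al0); move: e1; rewrite normrM (gtr0_norm al0).
by move: a_large; rewrite -/al; lra.
Qed.

(** The system for the correction vector, which lives on the first [de] columns. Row [k0] is divided
    by its pivot to bring the matrix close to the identity. *)
Let M : 'M[R]_de := \matrix_(k, l)
  if k == k0 then a (col l) / a (col k0) else x k (col l).

(** Every entry is within [3 eps] of the identity, and [d eps <= 1/6]. *)
Let M_dom k : \sum_l `|M k l - (k == l)%:R| <= 2^-1.
Proof.
have al0 : 0 < a (col k0) by rewrite -(pmulr_lgt0 _ eps0) (lt_le_trans ltr01).
apply: (@le_trans _ _ (\sum_(l < de) 3 * eps)).
  apply: ler_sum => l _; rewrite mxE; case: eqVneq => [->|kk0].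
    have [<-|lk0] := eqVneq k0 l.
      by rewrite divff ?gt_eqF// subrr normr0 mulr_ge0// ltW.
    rewrite subr0 normrM normfV (gtr0_norm al0) ler_pdivrMr//.
    have : `|a (col l)| <= eps * a (col k0).
      by apply: a_small; rewrite (inj_eq col_inj) eq_sym.
    by move/le_trans; apply; rewrite ler_wpM2r ?(ltW al0)//; move: eps0; lra.
  have [->|lk0] := eqVneq l k0.
    by rewrite (negbTE kk0) subr0 x_pivot_small.
  have := @x_close k (col l) kk0; rewrite !(inj_eq col_inj) => /(_ lk0).
  by rewrite (eq_sym l) => /le_trans; apply; move: eps0; lra.
rewrite sumr_const card_ord -[X in X <= _]mulr_natl.
apply: (@le_trans _ _ (d%:R * (3 * eps))).
  by rewrite ler_wpM2r ?ler_nat// mulr_ge0// ltW.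
by move: d_eps; lra.
Qed.

(* The vector a / |a|^2, which solves the k0-th equation, is corrected by an
   orthogonal vector of size O(|a|^-2): this perturbs |a|^-2 only to second
   order. *)
Lemma exists_short_solution : exists y : 'I_d -> R,
  (forall k, \sum_l A k l * y l = z k) /\ \sum_l y l ^+ 2 <= (h ^+ 2)^-1.
Proof.
have al0 : 0 < a (col k0) by rewrite -(pmulr_lgt0 _ eps0) (lt_le_trans ltr01).
have h20 : 0 < h ^+ 2 by rewrite exprn_gt0.
have L20 : 0 < L2 by apply: lt_le_trans L2h; rewrite ltr_pwDl// mulr_ge0.
(* The zero in row [k0] makes the correction orthogonal to [a]; the other entries cancel the
   products of the [x_k] with [a / L2]. *)
pose r : 'cV[R]_de := \col_k
  if k == k0 then 0 else - (\sum_l x k l * a l) / L2.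
have rle k : `|r k 0| <= L2^-1.
  rewrite mxE; case: eqP => [_|/eqP kk0]; first by rewrite normr0 invr_ge0 ltW.
  by rewrite normrM normrN normfV (gtr0_norm L20) ler_piMl ?invr_ge0 ?(ltW L20)// x_orth.
have [v Mv vle] := diag_dominant_solve M_dom rle.
(* The correction [v], extended by zero beyond the first [de] columns. *)
pose y' l := \sum_k (l == col k)%:R * v k 0.
have sum_y' (f : 'I_d -> R) : \sum_l f l * y' l = \sum_k f (col k) * v k 0.
  under eq_bigr do rewrite mulr_sumr.
  rewrite exchange_big/=; apply: eq_bigr => k _.
  rewrite (bigD1 (col k))//= eqxx mul1r big1 ?addr0// => l /negbTE ->.
  by rewrite mul0r mulr0.
have y'_col k : y' (col k) = v k 0.
  rewrite /y' (bigD1 k)//= eqxx mul1r big1 ?addr0// => j jk.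
  by rewrite (inj_eq col_inj) eq_sym (negbTE jk) mul0r.
have Mvk k : \sum_l M k l * v l 0 = r k 0 by rewrite -Mv mxE.
have ay' : \sum_l a l * y' l = 0.
  rewrite sum_y'; have := Mvk k0; rewrite mxE eqxx => e.
  have -> : \sum_k a (col k) * v k 0 = a (col k0) * \sum_l M k0 l * v l 0.
    rewrite mulr_sumr; apply: eq_bigr => k _; rewrite mxE eqxx; field.
    by rewrite gt_eqF.
  by rewrite e mulr0.
have xy' k : k != k0 -> \sum_l x k l * y' l = - (\sum_l x k l * a l) / L2.
  move=> kk0; rewrite sum_y'; have := Mvk k; rewrite mxE (negbTE kk0) => <-.
  by apply: eq_bigr => l _; rewrite mxE (negbTE kk0).
pose w l := a l / L2 + y' l.
have aw : \sum_l a l * w l = 1.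
  under eq_bigr do rewrite mulrDr mulrA.
  rewrite big_split/= ay' addr0 -mulr_suml.
  under eq_bigr do rewrite -expr2.
  by rewrite divff// gt_eqF.
have xw k : k != k0 -> \sum_l x k l * w l = 0.
  move=> kk0; under eq_bigr do rewrite mulrDr mulrA.
  by rewrite big_split/= xy'// -mulr_suml mulNr subrr.
have ww : \sum_l w l ^+ 2 <= (h ^+ 2)^-1.
  have -> : \sum_l w l ^+ 2 = L2^-1 + \sum_k v k 0 ^+ 2.
    transitivity (L2^-1 ^+ 2 * L2 + 2 * L2^-1 * \sum_l a l * y' l +
        \sum_l y' l * y' l).
      rewrite {2}/L2 !mulr_sumr -!big_split/=; apply: eq_bigr => l _.
      by rewrite /w; field; rewrite gt_eqF.
    rewrite ay' mulr0 addr0 sum_y' expr2 mulfVK ?gt_eqF//; congr (_ + _).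
    by apply: eq_bigr => k _; rewrite y'_col expr2.
  have vv : \sum_k v k 0 ^+ 2 <= 4 * d%:R * L2^-1 ^+ 2.
    apply: (@le_trans _ _ (\sum_(k < de) (2 * L2^-1) ^+ 2)).
      apply: ler_sum => k _; rewrite -real_normK ?num_real//.
      by rewrite ler_pXn2r ?nnegrE// ?vle// mulr_ge0// invr_ge0 ltW.
    rewrite sumr_const card_ord exprMn -[X in X <= _]mulr_natl.
    rewrite (_ : 4 * d%:R * _ = d%:R * (2 ^+ 2 * L2^-1 ^+ 2)); last by ring.
    by rewrite ler_wpM2r ?ler_nat// mulr_ge0// sqr_ge0.
  apply: (@le_trans _ _ (L2^-1 + 4 * d%:R * L2^-1 ^+ 2)); first by rewrite lerD2l.
  have -> : L2^-1 + 4 * d%:R * L2^-1 ^+ 2 = (L2 + 4 * d%:R) / L2 ^+ 2.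
    by field; rewrite gt_eqF.
  (* By [L2h], [(L2 + 4 d) h^2 <= (L2 + 4 d)(L2 - 4 d) <= L2^2]. The margin [4 d] over [h^2] absorbs
     the squared norm of the correction. *)
  rewrite ler_pdivrMr ?exprn_gt0// [leRHS]mulrC ler_pdivlMr//.
  have : 0 <= 4 * d%:R :> R by rewrite mulr_ge0.
  move: (4 * d%:R) L2h => D4 LD D40.
  have : (h ^+ 2 + D4) * L2 <= L2 * L2 by rewrite ler_wpM2r// ltW.
  have : D4 * h ^+ 2 <= D4 * L2 by rewrite ler_wpM2l//; lra.
  by rewrite (expr2 L2); lra.
exists (fun l => z k0 * w l); split=> [k|].
  have -> : \sum_l A k l * (z k0 * w l) = z k0 * \sum_l A k l * w l.
    by rewrite mulr_sumr; apply: eq_bigr => l _; ring.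
  have [->|kk0] := eqVneq k k0; first by rewrite aw mulr1.
  have -> : \sum_l A k l * w l = s k * \sum_l a l * w l + \sum_l x k l * w l.
    rewrite mulr_sumr -big_split/=; apply: eq_bigr => l _.
    by rewrite /x; ring.
  by rewrite aw xw// addr0 mulr1 (zE kk0) mulrC.
apply: le_trans ww; apply: ler_sum => l _; rewrite exprMn ler_piMl ?sqr_ge0//.
by rewrite -real_normK ?num_real// exprn_ile1.
Qed.

End short_solution.

(** * Probability of the cells *)

Section cells.
Context {R : realType} {D d : nat}.
Notation I := ('I_D * 'I_d)%type.
Notation sqrt2pi := (Num.sqrt (pi *+ 2) : R).
Variables (lc : 'I_d) (h : R).
Hypothesis h12 : 12 * d%:R <= h.
Implicit Types (x y : I -> R) (S : set (I -> R)) (r : seq I) (i : 'I_D).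

(** [eps] is chosen so that [d eps = 1/6]. [lam] bounds below the length of the interval left to the
    pivot entry of a row, given that pivots are at most [(4 d + 2) h]. *)
Let eps : R := (6 * d%:R)^-1.
Let lam : R := (8 * d%:R + 4)^-1 / h.

Definition others : seq 'I_d := [seq l <- enum 'I_d | l != lc].

Lemma others_uniq : uniq others.
Proof. by rewrite filter_uniq// enum_uniq. Qed.

Lemma mem_others l : (l \in others) = (l != lc).
Proof. by rewrite mem_filter mem_enum andbT. Qed.

Lemma size_others : size others = d.-1.
Proof.
have := count_predC (pred1 lc) (enum 'I_d).
rewrite count_uniq_mem ?enum_uniq// mem_enum size_enum_ord => dE.
by rewrite size_filter -[in RHS]dE.
Qed.

Lemma sum_others (V : nmodType) (f : 'I_d -> V) :
  \sum_l f l = f lc + \sum_(l <- others) f l.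
Proof. by rewrite (bigD1 lc)//= big_filter big_enum_cond. Qed.

Lemma dim_ge1 : 1 <= d%:R :> R.
Proof. by rewrite ler1n (leq_ltn_trans (leq0n lc) (ltn_ord lc)). Qed.

Lemma h_gt0 : 0 < h. Proof. by have := dim_ge1; move: h12; lra. Qed.

Lemma eps_gt0 : 0 < eps.
Proof. by rewrite invr_gt0; have := dim_ge1; lra. Qed.

Lemma d_epsE : d%:R * eps = 6^-1.
Proof. by rewrite /eps; field; have := dim_ge1; lra. Qed.

(** The pivot entry turns out to be at least [h / 2], so the other entries are at most [eps] times
    the pivot. *)
Definition first_cell (a : 'I_d -> R) : Prop :=
  [/\ 0 < a lc, forall l, l != lc -> `|a l| <= eps / 2 * h,
      h ^+ 2 + 4 * d%:R <= \sum_l a l ^+ 2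
    & \sum_l a l ^+ 2 <= h ^+ 2 + 4 * d%:R + 1].

(** The pivot entry of [b] is restricted only through the near orthogonality of [b - s a] to [a]. *)
Definition next_cell (a : 'I_d -> R) (s : R) (l1 : 'I_d) (b : 'I_d -> R) : Prop :=
  (forall l, l != lc -> `|b l - s * a l - (l == l1)%:R| <= eps) /\
  `|\sum_l (b l - s * a l) * a l| <= 1.

(** The other entries contribute at most [h^2/4] to the squared norm, which leaves at least [h^2/4]
    to the pivot. The upper bound is crude: [h^2 + 4 d + 1 <= (4 d + 2) h^2]. *)
Lemma first_cell_pivot a : first_cell a ->
  h / 2 <= a lc /\ a lc <= (4 * d%:R + 2) * h.
Proof.
move=> [a0 asmall aL aU].
have h0 := h_gt0; have d0 := dim_ge1; have e0 := eps_gt0.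
have oth : \sum_(l <- others) a l ^+ 2 <= h ^+ 2 / 4.
  apply: (@le_trans _ _ (\sum_(l <- others) (eps / 2 * h) ^+ 2)).
    rewrite big_seq [leRHS]big_seq; apply: ler_sum => l; rewrite mem_others => ll.
    rewrite -real_normK ?num_real// ler_pXn2r ?nnegrE ?asmall//.
    by rewrite !mulr_ge0// ltW.
  rewrite big_const_seq count_predT size_others iter_addr_0 -[X in X <= _]mulr_natl.
  apply: (@le_trans _ _ (d%:R * (eps / 2 * h) ^+ 2)).
    by rewrite ler_wpM2r ?sqr_ge0// ler_nat leq_pred.
  rewrite (_ : d%:R * (eps / 2 * h) ^+ 2 = (d%:R * eps) * eps * (h ^+ 2 / 4));
    last by field.
  rewrite ler_piMl ?divr_ge0 ?sqr_ge0// d_epsE.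
  have : eps <= 1 by rewrite invf_le1; lra.
  lra.
move: aL aU; rewrite sum_others => aL aU; split.
  rewrite -(@ler_pXn2r _ 2) ?nnegrE ?divr_ge0 ?(ltW h0) ?(ltW a0)//.
  by rewrite expr_div_n; have := sqr_ge0 h; lra.
rewrite -(@ler_pXn2r _ 2) ?nnegrE ?(ltW a0)//; last by rewrite mulr_ge0 ?(ltW h0)//; lra.
have o0 : 0 <= \sum_(l <- others) a l ^+ 2 by apply: sumr_ge0 => l _; exact: sqr_ge0.
have h1 : 1 <= h ^+ 2 by rewrite exprn_ege1//; move: h12; lra.
apply: (@le_trans _ _ (h ^+ 2 * (4 * d%:R + 2))).
  have : 4 * d%:R + 1 <= (4 * d%:R + 1) * h ^+ 2 by rewrite ler_peMr//; lra.
  lra.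
rewrite exprMn mulrC ler_wpM2r ?sqr_ge0// expr2 ler_peMr//; lra.
Qed.

(** Given the other entries, with sum of squares [W], the pivot ranges over [[sqrt P, sqrt (P + 1)]]
    with [P = h^2 + 4 d - W]. The other entries have intervals of length [eps h], the source of the
    power of [h] in the rate. *)
Lemma first_row_ge i r x S c : 0 <= c ->
  (forall y, (forall j, j.1 != i -> y j = x j) ->
     first_cell (fun l => y (i, l)) -> (c%:E <= gprob y r S)%E) ->
  ((c * (expR (- (h ^+ 2 + 4 * d%:R + 1) / 2) * (lam / sqrt2pi) *
     (eps * h / sqrt2pi) ^+ d.-1))%:E <=
     gprob x (map (pair i) others ++ (i, lc) :: r) S)%E.
Proof.
move=> c0 H.
have h0 := h_gt0; have d0 := dim_ge1; have e0 := eps_gt0.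
pose lo (j : I) := - (eps / 2 * h); pose hi (j : I) := eps / 2 * h.
pose W y := \sum_(j <- map (pair i) others) y j ^+ 2.
pose lend y := Num.sqrt (h ^+ 2 + 4 * d%:R - W y).
pose rend y := Num.sqrt (h ^+ 2 + 4 * d%:R + 1 - W y).
have pair_inj : injective (pair i : 'I_d -> I) by move=> l l' [].
have /= := @gprob_row_ge _ _ (map (pair i) others) (i, lc) r x S lo hi lend rend
  lam (h ^+ 2 + 4 * d%:R + 1) c.
rewrite (_ : \prod_(j <- _) _ = (eps * h / sqrt2pi) ^+ d.-1); last first.
  rewrite (eq_bigr (fun=> eps * h / sqrt2pi)).
    by rewrite big_const_seq count_predT size_map size_others iter_mulr_1.
  by move=> j _; rewrite /hi /lo; congr (_ / _); field.
rewrite -!mulrA => /(_ _ c0); rewrite !mulrA; apply.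
- by rewrite map_inj_uniq// others_uniq.
- by rewrite divr_ge0 ?invr_ge0 ?(ltW h0)//; lra.
- by move=> j _; rewrite /lo /hi; have := mulr_gt0 e0 h0; lra.
move=> y yx yI.
have ysmall l : l != lc -> `|y (i, l)| <= eps / 2 * h.
  rewrite -mem_others => ll.
  by rewrite ler_norml; apply: yI; rewrite map_f.
have W0 : 0 <= W y by apply: sumr_ge0 => j _; exact: sqr_ge0.
have Wh : W y <= h ^+ 2 / 2.
  apply: (@le_trans _ _ (\sum_(j <- map (pair i) others) (eps / 2 * h) ^+ 2)).
    rewrite /W !big_map big_seq [leRHS]big_seq; apply: ler_sum => l.
    rewrite mem_others => ll.
    rewrite -real_normK ?num_real// ler_pXn2r ?nnegrE ?ysmall//.
    by rewrite !mulr_ge0// ltW.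
  rewrite big_const_seq count_predT size_map size_others iter_addr_0.
  rewrite -[X in X <= _]mulr_natl.
  apply: (@le_trans _ _ (d%:R * (eps / 2 * h) ^+ 2)).
    by rewrite ler_wpM2r ?sqr_ge0// ler_nat leq_pred.
  rewrite (_ : d%:R * (eps / 2 * h) ^+ 2 = (d%:R * eps) * eps * (h ^+ 2 / 4));
    last by field.
  rewrite d_epsE; have : eps <= 1 by rewrite invf_le1; lra.
  move=> e1; have : eps * (h ^+ 2 / 4) <= 1 * (h ^+ 2 / 4).
    by rewrite ler_wpM2r// divr_ge0// sqr_ge0.
  by have := sqr_ge0 h; lra.
have h20 : 0 < h ^+ 2 by rewrite exprn_gt0.
set P := h ^+ 2 + 4 * d%:R - W y.
have P0 : 0 < P by rewrite /P; lra.
have lendE : lend y = Num.sqrt P by [].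
have rendE : rend y = Num.sqrt (P + 1) by rewrite /rend; congr Num.sqrt; rewrite /P; ring.
have l0 : 0 < lend y by rewrite lendE sqrtr_gt0.
have lP : lend y ^+ 2 = P by rewrite lendE sqr_sqrtr// ltW.
have r0 : 0 < rend y by rewrite rendE sqrtr_gt0; lra.
have rP : rend y ^+ 2 = P + 1 by rewrite rendE sqr_sqrtr//; lra.
split.
  have rb : rend y <= (4 * d%:R + 2) * h.
    rewrite -(@ler_pXn2r _ 2) ?nnegrE ?(ltW r0)//; last first.
      by rewrite mulr_ge0 ?(ltW h0)//; lra.
    have h1 : 1 <= h ^+ 2 by rewrite exprn_ege1//; move: h12; lra.
    rewrite rP; apply: (@le_trans _ _ (h ^+ 2 * (4 * d%:R + 2))).
      have : 4 * d%:R + 1 <= (4 * d%:R + 1) * h ^+ 2 by rewrite ler_peMr//; lra.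
      by rewrite /P; lra.
    rewrite exprMn mulrC ler_wpM2r ?sqr_ge0// expr2 ler_peMr//; lra.
  have lr : lend y <= rend y.
    by rewrite -(@ler_pXn2r _ 2) ?nnegrE ?(ltW l0) ?(ltW r0)// rP lP lerDl.
  (* The squares of the endpoints differ by 1, so the length is the inverse of their sum, which is
     at most [(8 d + 4) h]. *)
  have : (rend y - lend y) * (rend y + lend y) = 1.
    by rewrite -subr_sqr rP lP; ring.
  move=> E1; rewrite /lam -invfM -div1r ler_pdivrMr; last by rewrite mulr_gt0//; lra.
  rewrite -[leLHS]E1 ler_wpM2l ?subr_ge0//.
  by move: rb lr; rewrite !mulrDl; lra.
move=> t /andP[lt tr].
have t0 : 0 < t by exact: lt_le_trans lt.
have tl : P <= t ^+ 2 by rewrite -lP ler_pXn2r ?nnegrE ?(ltW l0) ?(ltW t0).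
have tu : t ^+ 2 <= P + 1 by rewrite -rP ler_pXn2r ?nnegrE ?(ltW r0) ?(ltW t0).
split; first by rewrite -/(W y); move: tu; rewrite /P; lra.
have sumE : \sum_l upd y (i, lc) t (i, l) ^+ 2 = t ^+ 2 + W y.
  rewrite sum_others upd_same /W big_map; congr (_ + _).
  rewrite big_seq [RHS]big_seq; apply: eq_bigr => l; rewrite mem_others => ll.
  by rewrite upd_other// xpair_eqE eqxx.
apply: H.
  move=> j ji; rewrite upd_other.
    by apply: yx; apply: contra ji => /mapP[l _ ->].
  by apply: contra ji => /eqP ->.
split; rewrite ?sumE; first by rewrite upd_same.
- by move=> l ll; rewrite upd_other ?ysmall// xpair_eqE eqxx.
- by move: tl; rewrite /P; lra.
- by move: tu; rewrite /P; lra.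
Qed.


(** Given the other entries, [|x . a| <= 1] with [x = b - s a] leaves the pivot an interval of
    length [2 / a_lc]. The squared norm of [b] is [s^2 |a|^2 + 2 s (x . a) + |x|^2], at most
    [(h^2 + 4 d + 1) + 2 + (1 + 4 d)]. *)
Lemma next_row_ge a s l1 i r x S c : 0 <= c -> first_cell a -> `|s| <= 1 ->
  (forall y, (forall j, j.1 != i -> y j = x j) ->
     next_cell a s l1 (fun l => y (i, l)) -> (c%:E <= gprob y r S)%E) ->
  ((c * (expR (- (h ^+ 2 + 8 * d%:R + 4) / 2) * (lam / sqrt2pi) *
     (2 * eps / sqrt2pi) ^+ d.-1))%:E <=
     gprob x (map (pair i) others ++ (i, lc) :: r) S)%E.
Proof.
move=> c0 fa s1 H.
have [alo ahi] := first_cell_pivot fa; case: fa => a0 asmall aL aU.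
have h0 := h_gt0; have d0 := dim_ge1; have e0 := eps_gt0.
have hge : 12 <= h by move: h12; lra.
have e6 : eps <= 6^-1.
  by rewrite lef_pV2 ?posrE ?ler_peMr//; lra.
pose lo (j : I) := s * a j.2 + (j.2 == l1)%:R - eps.
pose hi (j : I) := s * a j.2 + (j.2 == l1)%:R + eps.
pose W y := \sum_(l <- others) (y (i, l) - s * a l) * a l.
pose lend y := s * a lc + (- 1 - W y) / a lc.
pose rend y := s * a lc + (1 - W y) / a lc.
have pair_inj : injective (pair i : 'I_d -> I) by move=> l l' [].
have /= := @gprob_row_ge _ _ (map (pair i) others) (i, lc) r x S lo hi lend rend
  lam (h ^+ 2 + 8 * d%:R + 4) c.
rewrite (_ : \prod_(j <- _) _ = (2 * eps / sqrt2pi) ^+ d.-1); last first.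
  rewrite (eq_bigr (fun=> 2 * eps / sqrt2pi)).
    by rewrite big_const_seq count_predT size_map size_others iter_mulr_1.
  by move=> j _; rewrite /hi /lo; congr (_ / _); ring.
rewrite -!mulrA => /(_ _ c0); rewrite !mulrA; apply.
- by rewrite map_inj_uniq// others_uniq.
- by rewrite divr_ge0 ?invr_ge0 ?(ltW h0)//; lra.
- by move=> j _; rewrite /lo /hi; lra.
move=> y yx yI.
have yclose l : l != lc -> `|y (i, l) - s * a l - (l == l1)%:R| <= eps.
  rewrite -mem_others => ll.
  have /andP[] := yI (i, l) (map_f _ ll).
  by rewrite /lo /hi/= => y1 y2; rewrite ler_norml; apply/andP; split; lra.
have ynorm l : l != lc -> `|y (i, l) - s * a l| <= eps + (l == l1)%:R.
  move=> ll; have := yclose l ll; set b := (_ == _)%:R => yb.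
  have b0 : 0 <= b by rewrite ler0n.
  have := ler_normD (y (i, l) - s * a l - b) b; rewrite subrK (ger0_norm b0).
  by move=> /le_trans; apply; rewrite lerD2r.
have Wle : `|W y| <= eps * h.
  apply: le_trans (ler_norm_sum _ _ _) _.
  apply: (@le_trans _ _ (\sum_(l <- others) (eps + (l == l1)%:R) * (eps / 2 * h))).
    rewrite big_seq [leRHS]big_seq; apply: ler_sum => l; rewrite mem_others => ll.
    by rewrite normrM ler_pM// ?ynorm// asmall.
  rewrite -mulr_suml.
  have : \sum_(l <- others) (eps + (l == l1)%:R) <= 2.
    apply: (@le_trans _ _ (\sum_l (eps + (l == l1)%:R))).
      by rewrite sum_others lerDr addr_ge0// ltW.
    rewrite big_split/= sumr_const card_ord (bigD1 l1)//= eqxx big1 => [|l /negbTE ->//].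
    by rewrite addr0 -[eps *+ d]mulr_natl d_epsE mulr1n; lra.
  have : 0 <= eps / 2 * h by rewrite !mulr_ge0// ltW.
  move=> k0 kS; apply: (@le_trans _ _ (2 * (eps / 2 * h))); last by lra.
  by rewrite ler_wpM2r.
split.
  rewrite (_ : rend y - lend y = 2 / a lc); last first.
    by rewrite /rend /lend; field; rewrite gt_eqF.
  have lam0 : 0 <= lam by rewrite divr_ge0 ?invr_ge0 ?(ltW h0)//; lra.
  rewrite ler_pdivlMr//; apply: (@le_trans _ _ (lam * ((4 * d%:R + 2) * h))).
    by rewrite ler_wpM2l.
  rewrite (_ : lam * ((4 * d%:R + 2) * h) = 2^-1); first by lra.
  by rewrite /lam; field; rewrite gt_eqF//= gt_eqF//; lra.
move=> t /andP[lt tr].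
pose xl := t - s * a lc.
have xi1 : `|xl * a lc + W y| <= 1.
  have lt' : (- 1 - W y) / a lc <= xl by move: lt; rewrite /lend /xl; lra.
  have tr' : xl <= (1 - W y) / a lc by move: tr; rewrite /rend /xl; lra.
  move: lt' tr'; rewrite ler_pdivrMr// ler_pdivlMr// => lt' tr'.
  by rewrite ler_norml; apply/andP; split; lra.
(* Here [|xl| a_lc <= 1 + eps h <= 1 + h / 6 <= h / 2 <= a_lc], because [h >= 12]. *)
have xl1 : `|xl| <= 1.
  have := ler_normB (xl * a lc + W y) (W y); rewrite addrK normrM (gtr0_norm a0).
  move=> xa; rewrite -(ler_pM2r a0) mul1r.
  have : eps * h <= 6^-1 * h by rewrite ler_wpM2r// ltW.
  by lra.
have sumx2 : \sum_(l <- others) (y (i, l) - s * a l) ^+ 2 <= 4 * d%:R.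
  apply: (@le_trans _ _ (\sum_(l <- others) 4)).
    rewrite big_seq [leRHS]big_seq; apply: ler_sum => l; rewrite mem_others => ll.
    rewrite -real_normK ?num_real// (_ : 4 = 2 ^+ 2); last by ring.
    rewrite ler_pXn2r ?nnegrE//; apply: (le_trans (ynorm _ ll)).
    by case: (l == l1); rewrite ?mulr1n ?mulr0n; lra.
  rewrite big_const_seq count_predT size_others iter_addr_0 -[X in X <= _]mulr_natr.
  by rewrite ler_wpM2l// ler_nat leq_pred.
have xl2 : xl ^+ 2 <= 1 by rewrite -real_normK ?num_real// exprn_ile1.
split.
  rewrite big_map.
  have -> : \sum_(l <- others) y (i, l) ^+ 2 + t ^+ 2 =
      s ^+ 2 * (\sum_l a l ^+ 2) + 2 * s * (xl * a lc + W y) +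
      (xl ^+ 2 + \sum_(l <- others) (y (i, l) - s * a l) ^+ 2).
    rewrite sum_others.
    have -> : \sum_(l <- others) y (i, l) ^+ 2 =
        s ^+ 2 * \sum_(l <- others) a l ^+ 2 + 2 * s * W y +
        \sum_(l <- others) (y (i, l) - s * a l) ^+ 2.
      rewrite /W !mulr_sumr -!big_split/=; apply: eq_bigr => l _; ring.
    by rewrite /xl; ring.
  have s2 : s ^+ 2 <= 1 by rewrite -real_normK ?num_real// exprn_ile1.
  have : s ^+ 2 * (\sum_l a l ^+ 2) <= h ^+ 2 + 4 * d%:R + 1.
    apply: le_trans aU; rewrite ler_piMl//.
    by apply: sumr_ge0 => l _; exact: sqr_ge0.
  have : s * (xl * a lc + W y) <= 1.
    apply: le_trans (ler_norm _) _; rewrite normrM -[leRHS]mulr1.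
    exact: ler_pM.
  by lra.
apply: H.
  move=> j ji; rewrite upd_other.
    by apply: yx; apply: contra ji => /mapP[l _ ->].
  by apply: contra ji => /eqP ->.
split=> [l ll|].
  by rewrite upd_other ?yclose// xpair_eqE eqxx.
rewrite sum_others upd_same; move: xi1; rewrite /W -/xl.
congr (is_true (`| _ + _ | <= _)).
rewrite big_seq [RHS]big_seq; apply: eq_bigr => l; rewrite mem_others => ll.
by rewrite upd_other// xpair_eqE eqxx.
Qed.

End cells.

(** * All rows together *)

Section all_rows.
Context {R : realType} {D d : nat}.
Notation I := ('I_D * 'I_d)%type.
Notation sqrt2pi := (Num.sqrt (pi *+ 2) : R).
Variables (lc : 'I_d) (h : R).
Hypothesis h12 : 12 * d%:R <= h.
Implicit Types (x y : I -> R) (S : set (I -> R)) (r : seq I) (ks : seq 'I_D).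

Let eps : R := (6 * d%:R)^-1.
Let lam : R := (8 * d%:R + 4)^-1 / h.

(** The pivot entry comes last in its row because its interval depends on the others. Rows follow
    the order of [ks], so that a later row can be conditioned on the earlier ones. *)
Definition rows ks : seq I :=
  flatten [seq map (pair i) (others lc) ++ [:: (i, lc)] | i <- ks].

Lemma rows_cons_cat k ks r :
  rows (k :: ks) ++ r = map (pair k) (others lc) ++ (k, lc) :: (rows ks ++ r).
Proof. by rewrite /rows /= -!catA. Qed.

Lemma rows_cat ks ks' : rows (ks ++ ks') = rows ks ++ rows ks'.
Proof. by rewrite /rows map_cat flatten_cat. Qed.

Lemma mem_row (k : 'I_D) (j : I) :
  (j \in map (pair k) (others lc) ++ [:: (k, lc)]) = (j.1 == k).
Proof.
case: j => i l; rewrite mem_cat inE xpair_eqE /=.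
apply/idP/idP => [/orP[/mapP[l' _ [-> _]]//|/andP[]//]|/eqP ->].
rewrite eqxx /= orbC; have [//|ll] := eqVneq l lc.
by rewrite map_f// mem_others.
Qed.

Lemma mem_rows ks (j : I) : (j \in rows ks) = (j.1 \in ks).
Proof.
elim: ks => [//|k ks IH].
by rewrite /rows/= mem_cat mem_row -/(rows ks) IH inE.
Qed.

Lemma row_uniq (k : 'I_D) : uniq (map (pair k) (others lc) ++ [:: (k, lc)]).
Proof.
rewrite cat_uniq map_inj_uniq ?others_uniq//=; last by move=> l l' [].
rewrite orbF andbT; apply/mapP => -[l]; rewrite mem_others => ll [lE].
by rewrite -lE eqxx in ll.
Qed.

Lemma rows_uniq ks : uniq ks -> uniq (rows ks).
Proof.
elim: ks => [//|k ks IH] /= /andP[kks uks].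
rewrite /rows/= cat_uniq row_uniq -/(rows ks) IH// andbT /=.
apply/hasPn => j; rewrite mem_rows mem_row => jks.
by apply: contraNneq kks => <-.
Qed.

(** The vector [v] is already fixed when the bottom rows are drawn. Each of them therefore meets a
    slab of deviation [|v| <= 1/h], and the bounds of [slab_tail] multiply. *)
Lemma bottom_rows_ge ks x S (v : 'I_d -> R) : uniq ks ->
  \sum_l v l ^+ 2 <= (h ^+ 2)^-1 -> expR (- h ^+ 2 / 2) / h <= 1 ->
  (forall y, (forall j, j.1 \notin ks -> y j = x j) ->
     (forall k, k \in ks -> -1 <= \sum_l v l * y (k, l) <= 1) -> S y) ->
  (((1 - expR (- h ^+ 2 / 2) / h) ^+ size ks)%:E <= gprob x (rows ks) S)%E.
Proof.
move=> uks vh; set tau := expR _ / h => tau1.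
have h0 := h_gt0 lc h12.
elim: ks x uks => [|k ks IH] x /=.
  move=> _ H; rewrite expr0 indicE mem_set//.
  by apply: H => //; rewrite -vh.
move=> /andP[kks uks] H.
have c0 : 0 <= (1 - tau) ^+ size ks by rewrite exprn_ge0// subr_ge0.
have := @gprob_slab_ge _ _ (map (pair k) (others lc) ++ [:: (k, lc)]) (rows ks)
  x S (fun j => v j.2) _ 0 (row_uniq k) c0.
move=> slab_le.
rewrite /rows /= -/(rows ks); apply: le_trans (slab_le _); last first.
  move=> y yx yS; apply: IH => // y' y'y y'S; apply: H.
    move=> j; rewrite inE negb_or => /andP[jk jks].
    by rewrite y'y// yx// mem_row.
  move=> k'; rewrite inE => /predU1P[->|]; last exact: y'S.
  have -> : \sum_l v l * y' (k, l) = \sum_l v l * y (k, l).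
    by apply: eq_bigr => l _; rewrite y'y.
  move: yS; rewrite add0r big_cat big_map big_seq1/= addrC.
  by rewrite -(sum_others lc (fun l => v l * y (k, l))).
rewrite exprS mulrC EFinM lee_wpmul2l ?lee_fin//.
rewrite big_cat big_map big_seq1/= addrC -(sum_others lc (fun l => v l ^+ 2)).
apply: slab_tail => //.
have -> : 1 = Num.sqrt ((h ^+ 2)^-1) * h :> R.
  by rewrite -exprVn sqrtr_sqr gtr0_norm ?invr_gt0// mulVf// gt_eqF.
by rewrite ler_wpM2r ?(ltW h0)// ler_sqrt// ?invr_ge0 ?invr_gt0 ?exprn_gt0 ?sqr_ge0.
Qed.

Definition next_bound : R :=
  expR (- (h ^+ 2 + 8 * d%:R + 4) / 2) * (lam / sqrt2pi) *
    (2 * eps / sqrt2pi) ^+ d.-1.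

Definition first_bound : R :=
  expR (- (h ^+ 2 + 4 * d%:R + 1) / 2) * (lam / sqrt2pi) *
    (eps * h / sqrt2pi) ^+ d.-1.

Let lam_ge0 : 0 <= lam.
Proof.
have h0 := h_gt0 lc h12; have d1 := @dim_ge1 R d lc.
by rewrite divr_ge0 ?invr_ge0 ?(ltW h0)//; lra.
Qed.

Let eps_ge0 : 0 <= eps. Proof. exact: ltW (@eps_gt0 R d lc). Qed.

Lemma next_bound_ge0 : 0 <= next_bound.
Proof.
rewrite /next_bound mulr_ge0//; first by rewrite mulr_ge0 ?expR_ge0// divr_ge0.
by rewrite exprn_ge0// divr_ge0// mulr_ge0.
Qed.

Lemma next_rows_ge ks x S r c (a : 'I_d -> R) (s : 'I_D -> R) (l1 : 'I_D -> 'I_d) :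
  uniq ks -> 0 <= c -> first_cell lc h a -> (forall k, `|s k| <= 1) ->
  (forall y, (forall j, j.1 \notin ks -> y j = x j) ->
     (forall k, k \in ks -> next_cell lc a (s k) (l1 k) (fun l => y (k, l))) ->
     (c%:E <= gprob y r S)%E) ->
  ((c * next_bound ^+ size ks)%:E <= gprob x (rows ks ++ r) S)%E.
Proof.
move=> uks c0 fa s1; elim: ks x uks => [|k ks IH] x /=.
  by move=> _ H; rewrite expr0 mulr1; apply: H.
move=> /andP[kks uks] H.
rewrite rows_cons_cat exprSr mulrA.
apply: (next_row_ge h12 (l1 := l1 k) _ fa (s1 k)).
  by rewrite mulr_ge0// exprn_ge0// next_bound_ge0.
move=> y yx yk; apply: IH => // y' y'y y'ks; apply: H.
  move=> j; rewrite inE negb_or => /andP[jk jks].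
  by rewrite y'y// yx.
move=> k'; rewrite inE => /predU1P[->|]; last exact: y'ks.
rewrite (_ : (fun l => y' (k, l)) = (fun l => y (k, l)))//.
by apply/funext => l; rewrite y'y.
Qed.

(** Row [k0] is drawn first since the cells of the rows [ks] depend on it. The rows [bs] come last
    since their slabs depend on [v], which is built from the top rows. *)
Lemma rows_ge k0 ks bs x S (s : 'I_D -> R) (l1 : 'I_D -> 'I_d) :
  uniq (k0 :: ks ++ bs) -> expR (- h ^+ 2 / 2) / h <= 1 ->
  (forall k, `|s k| <= 1) ->
  (forall y, first_cell lc h (fun l => y (k0, l)) ->
     (forall k, k \in ks -> next_cell lc (fun l => y (k0, l)) (s k) (l1 k)
                              (fun l => y (k, l))) ->
     exists2 v : 'I_d -> R, \sum_l v l ^+ 2 <= (h ^+ 2)^-1 &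
       forall y', (forall j, j.1 \notin bs -> y' j = y j) ->
         (forall k, k \in bs -> -1 <= \sum_l v l * y' (k, l) <= 1) -> S y') ->
  (((1 - expR (- h ^+ 2 / 2) / h) ^+ size bs * next_bound ^+ size ks *
     first_bound)%:E <= gprob x (rows (k0 :: ks ++ bs)) S)%E.
Proof.
move=> /= /andP[]; rewrite mem_cat negb_or cat_uniq.
move=> /andP[k0ks k0bs] /and3P[uks /hasPn ksbs ubs] tau1 s1 H.
have c0 : 0 <= (1 - expR (- h ^+ 2 / 2) / h) ^+ size bs.
  by rewrite exprn_ge0// subr_ge0.
rewrite -[rows _]cats0 rows_cons_cat cats0 rows_cat.
apply: (first_row_ge h12).
  by rewrite mulr_ge0// exprn_ge0// next_bound_ge0.
move=> y yx fy; apply: (next_rows_ge uks c0 fy s1) => y' y'y nexty.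
have y'k0 : (fun l => y' (k0, l)) = (fun l => y (k0, l)).
  by apply/funext => l; rewrite y'y.
have fy' : first_cell lc h (fun l => y' (k0, l)) by rewrite y'k0.
have [|v vh vS] := H y' fy'; first by move=> k kks; rewrite y'k0; exact: nexty.
exact: bottom_rows_ge ubs vh tau1 vS.
Qed.

End all_rows.

(** * Measurability of success *)

Section success_measurable.
Context {R : realType}.

Lemma cvg_mx (T : Type) (F : set_system T) {FF : Filter F} m n
    (f : T -> 'M[R]_(m, n)) (A : 'M[R]_(m, n)) :
  (forall i j, (fun z => f z i j) @ F --> A i j) -> f @ F --> A.
Proof.
move=> fA V [B AB BV]; apply: filterS; first exact: BV.
rewrite /=; apply: filter_forall => i; apply: filter_forall => j.
exact: fA (AB i j).
Qed.

Lemma mulmx_continuous m n : continuous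
  (fun z : 'cV[R]_n * 'M[R]_(m, n) => z.2 *m z.1).
Proof.
move=> z; apply: cvg_mx => i j.
rewrite (_ : (fun _ => _) =
  (fun z : 'cV[R]_n * 'M[R]_(m, n) => \sum_k z.2 i k * z.1 k j)); last first.
  by apply/funext => w; rewrite mxE.
rewrite mxE; apply: cvg_big => [|k _]; [exact: add_continuous|apply: cvgM].
  apply: (@cvg_comp _ _ _ snd (fun A : 'M[R]_(m, n) => A i k)); first exact: cvg_snd.
  exact: coord_continuous.
apply: (@cvg_comp _ _ _ fst (fun A : 'cV[R]_n => A k j)); first exact: cvg_fst.
exact: coord_continuous.
Qed.

(** An open set is the union of the boxes with rational endpoints that it contains, and there are
    countably many of them. *)
Lemma open_measurable_coordT m n (O : set 'M[R]_(m, n)) : open O ->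
  measurable ([set x | O (\matrix_(i, j) x (i, j))] :
    set (@coordT R ('I_m * 'I_n)%type)).
Proof.
move=> oO.
pose Q := {ffun 'I_m * 'I_n -> rat * rat}.
pose bx (q : Q) : set ('I_m * 'I_n -> R) :=
  box (fun ij => [set t | ratr (q ij).1 < t < ratr (q ij).2]).
pose good (q : Q) := bx q `<=` [set x | O (\matrix_(i, j) x (i, j))].
have -> : [set x | O (\matrix_(i, j) x (i, j))] =
    \bigcup_(q in [set: Q]) (if `[< good q >] then bx q else set0).
  apply/seteqP; split => [x Ox|x [q _]]; last by case: asboolP => // gq; exact: gq.
  have := open_nbhs_nbhs (conj oO Ox); rewrite nbhs_ballP => -[e /= e0 xO].
  have qP (ij : 'I_m * 'I_n) : exists q : rat * rat,
      [/\ x ij - e < ratr q.1, ratr q.1 < x ij, x ij < ratr q.2 &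
          ratr q.2 < x ij + e].
    have /rat_in_itvoo[q1 /itvP q1P] : x ij - e < x ij by rewrite gtrBl.
    have /rat_in_itvoo[q2 /itvP q2P] : x ij < x ij + e by rewrite ltrDl.
    by exists (q1, q2); split; rewrite /= ?q1P ?q2P.
  have [q xq] := choice qP.
  exists [ffun ij => q ij] => //; case: asboolP => [_ ij|].
    by rewrite /= ffunE; have [_ -> ->] := xq ij.
  case=> y yq; apply: xO; split=> [//|i j]; rewrite !mxE /ball/=.
  have := yq (i, j); rewrite /= ffunE => /andP[y1 y2].
  have [x1 x2 x3 x4] := xq (i, j).
  by rewrite ltr_norml; apply/andP; split; lra.
apply: countable_bigcupT_measurable => [|q]; first exact: countableP.
case: ifP => _; last exact: measurable0.
apply: box_measurable => ij.
rewrite (_ : [set t | _] = `]ratr (q ij).1, ratr (q ij).2[%classic)//.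
Qed.

(** The minimizers in the cube form a closed set [K], and every [y] lies in some cube scaled by [n].
    For fixed [n], the matrices sending no point of the scaled cube into [K] form an open set, so
    success is a countable union of closed conditions. *)
Lemma success_measurable D d (f : 'cV[R]_D -> R) : continuous f ->
  measurable ([set x | RPX_successful f (\matrix_(i, j) x (i, j)) 0] :
    set (@coordT R ('I_D * 'I_d)%type)).
Proof.
move=> cf.
pose K := [set v | f v = fstar f /\ cube v].
have cK : open (~` K).
  apply: closed_openC; apply: closedI.
    apply: (@closed_comp _ _ f [set fstar f]) => [x _|]; first exact: cf.
    exact: closed_eq.
  apply: compact_closed; last exact: compact_cube.
  exact: norm_hausdorff.
pose O (n : nat) := [set A : 'M[R]_(D, d) |
  forall u : 'cV[R]_d, cube u -> ~ K (A *m (n%:R *: u))].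
have oO n : open (O n).
  rewrite openE => A OA.
  (* Compactness in its near-covering form: it suffices to avoid [K] for all pairs near [(u, A)],
     separately for each [u] in the cube. *)
  have := @compact_cube R d; rewrite compact_near_coveringP.
  move=> /(_ _ (nbhs A) (fun B u => ~ K (B *m (n%:R *: u))) _).
  apply=> u cu.
  have c : (fun z : 'cV[R]_d * 'M[R]_(D, d) => z.2 *m (n%:R *: z.1)) @ (u, A)
      --> A *m (n%:R *: u).
    rewrite -scalemxAr (_ : (fun _ => _) =
      (fun z : 'cV[R]_d * 'M[R]_(D, d) => n%:R *: (z.2 *m z.1))).
      apply: cvgZr; exact: (@mulmx_continuous D d (u, A)).
    by apply/funext => z; rewrite scalemxAr.
  exact: (c _ (open_nbhs_nbhs (conj cK (OA u cu)))).
rewrite (_ : [set x | _] = \bigcup_n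
    ~` [set x | O n (\matrix_(i, j) x (i, j))]); last first.
  apply/seteqP; split => [x [y]|x [n _ /existsNP[u /not_implyP[uc /contrapT uK]]]].
    rewrite addr0 => yK.
    pose n := Num.bound (\sum_i `|y i 0|).
    have n0 : 0 < n.+1%:R :> R by [].
    have yn i : `|y i 0| <= n.+1%:R.
      have b0 : 0 <= \sum_j `|y j 0| by apply: sumr_ge0.
      have := archi_boundP b0; rewrite -/n => yn.
      apply: (@le_trans _ _ n%:R); last by rewrite ler_nat.
      apply: le_trans (ltW yn); rewrite (bigD1 i)//= lerDl.
      exact: sumr_ge0.
    exists n.+1 => //= On; apply: (On (n.+1%:R^-1 *: y)).
      move=> i; rewrite mxE -ler_norml normrM gtr0_norm ?invr_gt0//.
      by rewrite mulrC ler_pdivrMr// mul1r.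
    by rewrite scalerA divff ?gt_eqF// scale1r.
  by exists (n%:R *: u); rewrite addr0.
apply: bigcupT_measurable => n; apply: measurableC.
exact: open_measurable_coordT.
Qed.

End success_measurable.

(** * The lower bound *)

Lemma bernoulli_ge (R : realFieldType) (t : R) n : 0 <= t <= 1 ->
  1 - n%:R * t <= (1 - t) ^+ n.
Proof.
move=> /andP[t0 t1]; elim: n => [|n IH]; first by rewrite mul0r subr0 expr0.
rewrite exprS; apply: (@le_trans _ _ ((1 - t) * (1 - n%:R * t))).
  rewrite -natr1; have : 0 <= n%:R * t * t by rewrite !mulr_ge0.
  by lra.
by rewrite ler_wpM2l// subr_ge0.
Qed.

(** Intermediate value theorem on [[h0, T]]: the exponential is at least 1, so the function is at
    least [T] at [T]. *)
Lemma exists_height (R : realType) (h0 T : R) : 1 <= h0 ->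
  h0 * expR (h0 ^+ 2 / 2) <= T ->
  exists2 h, h0 <= h & h * expR (h ^+ 2 / 2) = T.
Proof.
move=> h1 h0T.
pose g (x : R) := x * expR (x ^+ 2 / 2).
have e1 x : 1 <= expR (x ^+ 2 / 2) :> R.
  by rewrite -expR0 ler_expR divr_ge0// sqr_ge0.
have hT : h0 <= T by apply: le_trans h0T; rewrite ler_peMr//; lra.
have gT : T <= g T by rewrite ler_peMr//; lra.
have cg : {within `[h0, T], continuous g}.
  apply: continuous_subspaceT => x; apply: cvgM; first exact: cvg_id.
  apply: (cvg_comp _ expR); last exact: continuous_expR.
  by apply: cvgM; [exact: sqr_continuous|exact: cvg_cst].
have [|h] := @IVT R g h0 T T hT cg.
  by rewrite ge_min h0T /= le_max gT orbT.
by rewrite in_itv/= => /andP[hh _] gh; exists h.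
Qed.

(** Truncating a vector to its first [de] coordinates subtracts a vector orthogonal to the columns
    of [Umx], so [f] does not see the truncation. *)
Lemma constant_along_bottom (R : realType) D de (f : 'cV[R]_D -> R) :
  constant_along_orthocomp f (colspan (Umx R D de)) ->
  forall u v : 'cV[R]_D, (forall i : 'I_D, (i < de)%N -> u i 0 = v i 0) -> f u = f v.
Proof.
move=> fT.
pose top (v : 'cV[R]_D) : 'cV[R]_D := \col_i if (i < de)%N then v i 0 else 0.
have ftop v : f v = f (top v).
  rewrite -{1}(subrK (top v) v) addrC; apply: fT.
    (* A sum over at most one index, which reads coordinate [k] without a proof that [k < D]; it is
       0 when [k >= D]. *)
    pose c k := \sum_(i < D | i == k :> nat) v i 0.
    have cE (i : 'I_D) : c i = v i 0.
      rewrite /c (bigD1 i)//= big1 ?addr0// => j /andP[/eqP ji] /eqP.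
      by case; apply: val_inj.
    have -> : top v = \sum_(k < de) c k *: col k (Umx R D de).
      apply/colP => i; rewrite mxE summxE.
      under eq_bigr do rewrite !mxE.
      case: ltnP => [ik|ki].
        rewrite (bigD1 (Ordinal ik))//= eqxx mulr1 cE big1 ?addr0// => k kk.
        rewrite (_ : (i == k :> nat) = false) ?mulr0//.
        by apply: contraNF kk => /eqP ik'; apply/eqP/val_inj.
      rewrite big1// => k _; rewrite (_ : (i == k :> nat) = false) ?mulr0//.
      by apply: contraTF ki => /eqP ->; rewrite -ltnNge.
    apply: memv_suml => k _; apply: memvZ; apply: memv_span.
    by apply: map_f; rewrite mem_enum.
  move=> u uT; apply: big1 => i _; rewrite !mxE.
  case: ltnP => ik; first by rewrite subrr mulr0.
  (* Here [de <= i], and all columns of [Umx], hence all vectors of their span, vanish there. *)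
  suff -> : u i 0 = 0 by rewrite mul0r.
  rewrite (coord_span uT) summxE big1// => j _; rewrite mxE.
  set w : 'cV[R]_D := (X in fun_of_matrix X i 0).
  have /mapP[k _ ->] : w \in [seq col j (Umx R D de) | j <- enum 'I_de].
    by apply: mem_nth; rewrite size_map -cardE.
  rewrite !mxE (_ : (i == k :> nat) = false) ?mulr0//.
  by apply: contraTF ik => /eqP ->; rewrite -ltnNge.
move=> u v uv; rewrite ftop [RHS]ftop; congr f; apply/colP => i; rewrite !mxE.
by case: ltnP => // /uv.
Qed.

Section success_lower_bound.
Context {R : realType} {D de d : nat}.
Hypotheses (de_gt0 : (0 < de)%N) (le_de_d : (de <= d)%N) (lt_de_D : (de < D)%N).
Variables (f : 'cV[R]_D -> R) (h : R).
Hypothesis cf : continuous f.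
Hypothesis f_top : forall u v : 'cV[R]_D,
  (forall i : 'I_D, (i < de)%N -> u i 0 = v i 0) -> f u = f v.
Hypothesis h12 : 12 * d%:R <= h.
Hypothesis tau1 : expR (- h ^+ 2 / 2) / h <= 1.

Let toprow (k : 'I_de) : 'I_D := widen_ord (ltnW lt_de_D) k.
Let col (k : 'I_de) : 'I_d := widen_ord le_de_d k.
(** Extends data on the top rows to all rows, as [rows_ge] expects. With default 0 the ratios [s]
    stay bounded by 1 on every row. *)
Let row_of (T : Type) (x0 : T) (g : 'I_de -> T) (i : 'I_D) : T :=
  oapp g x0 (insub (i : nat)).

Let row_ofE T x0 (g : 'I_de -> T) k : row_of x0 g (toprow k) = g k.
Proof. by rewrite /row_of; case: insubP => [k' _ /val_inj->//|/=]; rewrite ltn_ord. Qed.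

Let toprow_inj : injective toprow.
Proof. by move=> i j /(congr1 val) /= ij; apply: val_inj. Qed.

(** The row [k0] and the order of integration depend on the minimizer of [f], while the bound does
    not. *)
Lemma success_gprob_ge : exists (k0 : 'I_de) (rs : seq 'I_D),
  [/\ uniq rs, forall i, i \in rs &
  forall x, (((1 - expR (- h ^+ 2 / 2) / h) ^+ (D - de) *
       @next_bound R d h ^+ de.-1 * @first_bound R d h)%:E <=
     gprob x (rows (col k0) rs)
       [set x | RPX_successful f (\matrix_(i, j) x (i, j)) 0])%E].
Proof.
have [[xs xs_cube fxs] _] := fstar_attained cf.
pose z k : R := xs (toprow k) 0.
have z1 k : `|z k| <= 1 by rewrite ler_norml; exact: xs_cube.
have [k0 _ k0max] := @Order.TotalTheory.arg_maxP _ _ _ (Ordinal de_gt0) xpredT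
  (fun k => `|z k|) isT.
(* If [z k0 = 0], then all [z k] vanish by maximality, and the convention [0^-1 = 0] makes [s1] and
   [zE] hold in this case too. *)
pose s k := z k / z k0.
have s1 k : `|s k| <= 1.
  have [z0|z0] := eqVneq (z k0) 0; first by rewrite /s z0 invr0 mulr0 normr0.
  by rewrite /s normrM normfV ler_pdivrMr ?normr_gt0// mul1r; exact: k0max.
have zE k : z k = s k * z k0.
  have [z0|z0] := eqVneq (z k0) 0; last by rewrite /s divfK.
  have := k0max k isT; rewrite /= z0 normr0 mulr0 normr_le0.
  by move=> /eqP.
pose ks := [seq toprow k | k <- enum 'I_de & k != k0].
pose bs := [seq i : 'I_D <- enum 'I_D | (de <= i)%N].
exists k0, (toprow k0 :: ks ++ bs).
have memks k : (toprow k \in ks) = (k != k0).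
  by rewrite mem_map// mem_filter mem_enum andbT.
have bs_top k : toprow k \notin bs by rewrite mem_filter /= leqNgt ltn_ord.
have is_uniq : uniq (toprow k0 :: ks ++ bs).
  rewrite /= mem_cat memks eqxx /= bs_top /= cat_uniq; apply/and3P; split.
  - by rewrite /ks map_inj_uniq// filter_uniq// enum_uniq.
  - apply/hasPn => i ibs.
    by apply/mapP => -[k _ ik]; have := bs_top k; rewrite -ik ibs.
  - by rewrite filter_uniq// enum_uniq.
have is_full i : i \in toprow k0 :: ks ++ bs.
  rewrite inE mem_cat mem_filter mem_enum andbT; case: leqP => [_|ik].
    by rewrite !orbT.
  have -> : i = toprow (Ordinal ik) by apply: val_inj.
  by rewrite memks (inj_eq toprow_inj) orbF; case: eqP.
split => // x.
have size_ks : size ks = de.-1.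
  rewrite size_map size_filter.
  have := count_predC (pred1 k0) (enum 'I_de).
  rewrite count_uniq_mem ?enum_uniq// mem_enum size_enum_ord => deE.
  by rewrite -[in RHS]deE.
have size_bs : size bs = (D - de)%N.
  have := card_uniqP is_uniq; rewrite (eq_card (B := 'I_D)) ?card_ord => [DE|i].
    by rewrite [in RHS]DE /= size_cat size_ks -addSn prednK// addKn.
  by rewrite is_full inE.
rewrite -size_bs -size_ks.
apply: (@rows_ge R D d (col k0) h h12 (toprow k0) ks bs x _
  (row_of 0 s) (row_of (col k0) col)) => //.
  by move=> i; rewrite /row_of; case: insubP => [k _ _|_] /=; rewrite ?normr0.
move=> y fy nexty.
set a := (fun l => y (toprow k0, l)) in fy nexty.
have h0 := h_gt0 (col k0) h12; have d0 := @dim_ge1 R d (col k0).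
have e0 := @eps_gt0 R d (col k0).
have [alo _] := first_cell_pivot h12 fy.
have a0 : 0 < a (col k0) by apply: lt_le_trans alo; rewrite divr_gt0.
have [_ asmall aL _] := fy.
have nextk k : k != k0 -> next_cell (col k0) a (s k) (col k) (fun l => y (toprow k, l)).
  by rewrite -memks => kks; have := nexty _ kks; rewrite !row_ofE.
have [||||||||||v [Av vh]] := @exists_short_solution R de d le_de_d
  (fun k l => y (toprow k, l)) k0 s z (6 * d%:R)^-1 h.
- exact: e0.
- by rewrite (@d_epsE R d (col k0)).
- exact: h0.
- by rewrite -/(a _) ler_pdivlMr ?mulr_gt0//; [move: alo h12; lra|lra].
- move=> l ll; apply: (le_trans (asmall l ll)).
  by rewrite -/(a _) -mulrA ler_wpM2l ?(ltW e0)//; move: alo; rewrite /a/=; lra.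
- exact: aL.
- by move=> k l kk0; have [+ _] := nextk k kk0; apply.
- by move=> k kk0; have [_] := nextk k kk0.
- exact: z1.
- by move=> k _; exact: zE.
exists v => // y' y'y slab_y'.
have Avi i : ((\matrix_(i, j) y' (i, j)) *m (\col_l v l)) i 0 =
    \sum_l v l * y' (i, l).
  by rewrite mxE; apply: eq_bigr => l _; rewrite !mxE mulrC.
(* Drawing the bottom rows leaves the top rows unchanged, so the equations solved by [v] survive. *)
have topE k : \sum_l v l * y' (toprow k, l) = z k.
  rewrite -Av; apply: eq_bigr => l _; rewrite mulrC y'y//; exact: bs_top.
exists (\col_l v l); rewrite addr0; split.
  rewrite -fxs; apply: f_top => i ik; rewrite Avi.
  by have -> : i = toprow (Ordinal ik) by exact: val_inj.
move=> i; rewrite Avi; case: (ltnP i de) => [ik|ik].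
  have -> : i = toprow (Ordinal ik) by exact: val_inj.
  by rewrite topE; exact: xs_cube.
by apply: slab_y'; rewrite mem_filter ik mem_enum.
Qed.

End success_lower_bound.

(** * The rate in terms of the number of bottom rows *)

Section rate.
Context {R : realType}.
Variables (de d : nat).
Hypotheses (de_gt0 : (0 < de)%N) (d_gt0 : (0 < d)%N).
Notation sqrt2pi := (Num.sqrt (pi *+ 2) : R).

(** One constant for both kinds of cells: the exponent is that of [next_bound], the larger loss, and
    the side is that of [first_bound] without its factor [h]. *)
Definition cell_const : R :=
  expR (- (8 * d%:R + 4) / 2) * ((8 * d%:R + 4)^-1 / sqrt2pi) *
    ((6 * d%:R)^-1 / sqrt2pi) ^+ d.-1.

(** The value of [h * expR (h ^+ 2 / 2)] at [h = 12 d]: every larger target is then reached at some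
    [h >= 12 d]. *)
Definition height_const : R := 12 * d%:R * expR ((12 * d%:R) ^+ 2 / 2).

(** The factor 1/2 comes from the bottom rows, and each of the [de] top rows gives one factor
    [cell_const / height_const]. *)
Definition tau_const : R := 2^-1 * (cell_const / height_const) ^+ de.

Let d1 : 1 <= d%:R :> R. Proof. by rewrite ler1n. Qed.

Let sqrt2pi_gt0 : 0 < sqrt2pi.
Proof. by rewrite sqrtr_gt0 mulrn_wgt0// pi_gt0. Qed.

Lemma cell_const_gt0 : 0 < cell_const.
Proof.
rewrite /cell_const !mulr_gt0 ?expR_gt0 ?exprn_gt0 ?divr_gt0 ?invr_gt0//; move: d1; lra.
Qed.

Lemma height_const_ge : 12 <= height_const.
Proof.
have e1 : 1 <= expR ((12 * d%:R) ^+ 2 / 2) :> R.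
  by rewrite -expR0 ler_expR divr_ge0// sqr_ge0.
apply: (@le_trans _ _ (12 * d%:R)); first by move: d1; lra.
by rewrite /height_const ler_peMr//; move: d1; lra.
Qed.

Lemma height_const_gt0 : 0 < height_const.
Proof. by apply: lt_le_trans height_const_ge. Qed.

Lemma tau_const_gt0 : 0 < tau_const.
Proof.
rewrite mulr_gt0 ?invr_gt0// exprn_gt0// divr_gt0//.
  exact: cell_const_gt0.
exact: height_const_gt0.
Qed.

Lemma next_bound_ge (h : R) : 0 < h ->
  cell_const * (expR (- h ^+ 2 / 2) / h) <= @next_bound R d h.
Proof.
move=> h0; rewrite /next_bound /cell_const.
have -> : - (h ^+ 2 + 8 * d%:R + 4) / 2 = - h ^+ 2 / 2 + - (8 * d%:R + 4) / 2 :> R.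
  by field.
rewrite expRD.
set E := expR (- h ^+ 2 / 2); set F := expR _; set e := (6 * d%:R)^-1.
have e0 : 0 <= e by rewrite invr_ge0 mulr_ge0.
have -> : F * ((8 * d%:R + 4)^-1 / sqrt2pi) * (e / sqrt2pi) ^+ d.-1 * (E / h) =
    E * F * ((8 * d%:R + 4)^-1 / h / sqrt2pi) * (e / sqrt2pi) ^+ d.-1 by ring.
rewrite ler_wpM2l//.
  by rewrite !mulr_ge0 ?expR_ge0 ?invr_ge0// ?(ltW h0)//; move: d1; lra.
apply: lerXn2r; rewrite ?nnegrE ?divr_ge0// ?mulr_ge0//.
by rewrite ler_wpM2r ?invr_ge0// ler_peMl//; move: d1; lra.
Qed.

Lemma first_bound_ge (h : R) : 0 < h ->
  cell_const * (expR (- h ^+ 2 / 2) / h) * h ^+ d.-1 <= @first_bound R d h.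
Proof.
move=> h0; rewrite /first_bound /cell_const.
set e := (6 * d%:R)^-1.
have e0 : 0 <= e by rewrite invr_ge0 mulr_ge0.
have -> : (e * h / sqrt2pi) ^+ d.-1 = (e / sqrt2pi) ^+ d.-1 * h ^+ d.-1.
  by rewrite -exprMn mulrAC.
rewrite [leRHS]mulrA ler_wpM2r ?exprn_ge0 ?(ltW h0)//.
set p := (e / sqrt2pi) ^+ d.-1.
have -> : expR (- (8 * d%:R + 4) / 2) * ((8 * d%:R + 4)^-1 / sqrt2pi) * p *
    (expR (- h ^+ 2 / 2) / h) =
    (expR (- h ^+ 2 / 2) * expR (- (8 * d%:R + 4) / 2)) *
    ((8 * d%:R + 4)^-1 / h / sqrt2pi) * p by ring.
rewrite ler_wpM2r ?exprn_ge0 ?divr_ge0//.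
apply: ler_wpM2r; last by rewrite -expRD ler_expR; move: d1; lra.
by rewrite !mulr_ge0 ?invr_ge0// ?(ltW h0)//; move: d1; lra.
Qed.

(* The height h is chosen so that phi(h)/h is of order 1/(N+1): the N bottom
   rows then leave the slab with probability at most 1/2, while h^(d-1) is at
   least ln(N+1)^((d-1)/2). *)
Lemma rate_le (N : nat) : exists2 h : R, 12 * d%:R <= h &
  expR (- h ^+ 2 / 2) / h <= 1 /\
  tau_const * (ln (N.+1%:R) `^ ((d%:R - 1) / 2) / N.+1%:R ^+ de) <=
    (1 - expR (- h ^+ 2 / 2) / h) ^+ N *
       @next_bound R d h ^+ de.-1 * @first_bound R d h.
Proof.
set X : R := N.+1%:R.
have X1 : 1 <= X by rewrite ler1n.
have M12 := height_const_ge; have M0 := height_const_gt0.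
have [||h hd hT] := @exists_height R (12 * d%:R) (height_const * X).
- by move: d1; lra.
- by rewrite -/height_const ler_peMr// ltW.
exists h => //.
have h12 : 12 <= h by move: d1; lra.
have h0 : 0 < h by move: d1; lra.
have tauE : expR (- h ^+ 2 / 2) / h = (height_const * X)^-1.
  by rewrite -hT mulNr expRN invfM mulrC.
have T0 : 0 < height_const * X by rewrite mulr_gt0//; move: d1; lra.
have T12 : 12 <= height_const * X.
  by apply: (le_trans M12); rewrite ler_peMr// ltW.
rewrite tauE.
have tau1 : (height_const * X)^-1 <= 1 by rewrite invf_le1//; move: d1; lra.
split => //.
(* Bernoulli's inequality, with [N / (height_const * X) <= 1/12]. *)
have half : 2^-1 <= (1 - (height_const * X)^-1) ^+ N.
  apply: le_trans (bernoulli_ge N _); last by rewrite invr_ge0 (ltW T0).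
  have : N%:R / (height_const * X) <= 2^-1.
    rewrite ler_pdivrMr//; have : N%:R <= X by rewrite ler_nat.
    have : 12 * X <= height_const * X by rewrite ler_wpM2r//; move: d1; lra.
    by move: d1; lra.
  by move: (_ / _) => q; lra.
have C0 := cell_const_gt0.
have nb : cell_const / (height_const * X) <= @next_bound R d h.
  by have := next_bound_ge h0; rewrite tauE.
have fb : cell_const / (height_const * X) * h ^+ d.-1 <= @first_bound R d h.
  by have := first_bound_ge h0; rewrite tauE.
have CT0 : 0 <= cell_const / (height_const * X) by rewrite divr_ge0 ?ltW.
have lnh : ln X `^ ((d%:R - 1) / 2) <= h ^+ d.-1.
  have lnX0 : 0 <= ln X by rewrite ln_ge0.
  have dE : (d%:R - 1 : R) = d.-1%:R.
    by rewrite -[in LHS](prednK d_gt0) -natr1 addrK.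
  (* Indeed [X <= height_const * X = h * expR (h ^+ 2 / 2) <= expR (h ^+ 2)]. *)
  have lnXh : ln X <= h ^+ 2.
    rewrite -ler_expR lnK ?posrE; last by move: d1; lra.
    have hE : h <= expR (h ^+ 2 / 2).
      apply: le_trans (expR_ge1Dx _).
      have hh : 12 * h <= h * h by rewrite ler_wpM2r// ltW.
      by rewrite expr2; lra.
    apply: (@le_trans _ _ (height_const * X)).
      by rewrite ler_peMl//; move: d1; lra.
    rewrite -hT (_ : expR (h ^+ 2) = expR (h ^+ 2 / 2) * expR (h ^+ 2 / 2)).
      by apply: ler_wpM2r; first exact: expR_ge0.
    by rewrite -expRD; congr expR; field.
  rewrite dE; apply: (@le_trans _ _ ((h ^+ 2) `^ (d.-1%:R / 2))).
    by apply: ge0_ler_powR; rewrite ?nnegrE ?sqr_ge0// divr_ge0.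
  rewrite -powR_mulrn ?(ltW h0)// -powRrM -powR_mulrn ?(ltW h0)//.
  by rewrite mulrC divfK.
apply: (@le_trans _ _ (2^-1 * (cell_const / (height_const * X)) ^+ de.-1 *
    (cell_const / (height_const * X) * h ^+ d.-1))).
  have -> : 2^-1 * (cell_const / (height_const * X)) ^+ de.-1 *
    (cell_const / (height_const * X) * h ^+ d.-1) =
    2^-1 * (cell_const / (height_const * X)) ^+ de * h ^+ d.-1.
    by rewrite -[in RHS](prednK de_gt0) exprSr; ring.
  have -> : tau_const * (ln X `^ ((d%:R - 1) / 2) / X ^+ de) =
    2^-1 * (cell_const / (height_const * X)) ^+ de * ln X `^ ((d%:R - 1) / 2).
    have -> : (cell_const / (height_const * X)) ^+ de =
        (cell_const / height_const) ^+ de / X ^+ de.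
      by rewrite -expr_div_n; congr (_ ^+ _); rewrite invfM mulrA.
    by rewrite /tau_const; ring.
  by rewrite ler_wpM2l// mulr_ge0 ?exprn_ge0.
apply: ler_pM => //.
- by rewrite mulr_ge0 ?exprn_ge0.
- by rewrite mulr_ge0 ?exprn_ge0 ?(ltW h0).
- apply: ler_pM => //; rewrite ?exprn_ge0//.
  by apply: lerXn2r; rewrite ?nnegrE ?(le_trans CT0).
Qed.

End rate.

Unset Implicit Arguments.

Theorem theorem3p9 (R : realType) (de d : nat) (de_gt0 : (0 < de)%N)
    (le_de_d : (de <= d)%N) :
  exists tau0 : nat -> R,
    (forall D : nat, (de < D)%N -> 0 < tau0 D) /\
    (tau0 : nat -> R^o) \is 'Theta_\oo (fun D : nat =>
       ln (D%:R - de%:R + 1) `^ ((d%:R - 1) / 2)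
         / (D%:R - de%:R + 1) ^+ de : R^o) /\
    (forall D : nat, (de < D)%N ->
     forall (disp : measure_display) (Omega : measurableType disp)
       (P : probability Omega R) (A : Omega -> 'M[R]_(D, d))
       (f : 'cV[R]_D -> R) (T : {vspace 'cV[R]_D}),
       gaussian_matrix P A ->
       continuous f ->
       effective_dimension f de ->
       effective_subspace f T ->
       T = colspan (Umx R D de) ->
       orthocomp T = [set` colspan (Vmx R D de)] ->
       let success := [set w | RPX_successful f (A w) 0] in
       measurable success /\ ((tau0 D)%:E <= P success)%E).
Proof.
have d_gt0 : (0 < d)%N by exact: leq_trans le_de_d.
have c0 := @tau_const_gt0 R de d d_gt0.
pose rate (D : nat) : R := ln (D%:R - de%:R + 1) `^ ((d%:R - 1) / 2)
         / (D%:R - de%:R + 1) ^+ de.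
(* An exact multiple of the rate, so both constants of the [Theta] bound equal [tau_const]. *)
exists (fun D => @tau_const R de d * rate D); split=> [D lt_de_D|].
  (* Strictly more than 1, so the logarithm is positive. *)
  have D1 : 1 < D%:R - de%:R + 1 :> R by rewrite ltrDr subr_gt0 ltr_nat.
  rewrite mulr_gt0// divr_gt0 ?exprn_gt0 ?powR_gt0 ?ln_gt0//.
  exact: lt_trans D1.
split.
  apply/asboolP; exists (@tau_const R de d, @tau_const R de d) => /=.
    by rewrite c0.
  apply: nearW => D /=.
  have E : `|@tau_const R de d * rate D| = @tau_const R de d * `|rate D|.
    by rewrite normrM (gtr0_norm c0).
  by split; rewrite le_eqVlt; apply/orP; left; apply/eqP; [exact: esym E|exact: E].
move=> D lt_de_D disp Omega P A f T [mA lawA indepA] cf _ [_ fT] TE _ /=.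
pose S : set ('I_D * 'I_d -> R) :=
  [set x | RPX_successful f (\matrix_(i, j) x (i, j)) 0].
have mS : measurable (S : set (@coordT R ('I_D * 'I_d)%type)).
  exact: success_measurable.
pose X (ij : 'I_D * 'I_d) w := A w ij.1 ij.2.
have successE : [set w | RPX_successful f (A w) 0] = [set w | S (X ^~ w)].
  apply/seteqP; rewrite /S; split => w /=;
    by rewrite (_ : \matrix_(i, j) _ = A w)//; apply/matrixP => i j; rewrite mxE.
rewrite successE; split.
  have mX : measurable_fun setT (fun w => X ^~ w : @coordT R ('I_D * 'I_d)%type).
    by apply: measurable_to_coordT => ij; exact: mA.
  by rewrite -[X in measurable X]setTI; exact: mX.
have [h hd [tau1 le_rate]] := @rate_le R de d de_gt0 d_gt0 (D - de).
have f_top : forall u v : 'cV[R]_D,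
    (forall i : 'I_D, (i < de)%N -> u i 0 = v i 0) -> f u = f v.
  by apply: constant_along_bottom; rewrite -TE.
have [k0 [rs [rs_uniq rs_full gprob_le]]] :=
  success_gprob_ge de_gt0 le_de_d lt_de_D cf f_top hd tau1.
(* The list [rows] contains every entry of the matrix, so any starting point represents the law of
   [A]; the zero matrix is taken. *)
rewrite (@law_gprob _ _ _ _ P X (fun=> 0) (rows (widen_ord le_de_d k0) rs))//.
- apply: le_trans (gprob_le _); rewrite lee_fin.
  have -> : rate D = ln ((D - de).+1%:R) `^ ((d%:R - 1) / 2) / (D - de).+1%:R ^+ de.
    by rewrite /rate -natrB 1?ltnW// natr1.
  exact: le_rate.
- exact: rows_uniq.
- by move=> ij; rewrite mem_rows.
- by move=> ij; exact: mA.
- by move=> ij B mB; exact: lawA.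
Qed.
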